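(* Let $(G,H)=(\mathrm O(p,q),\mathrm O(p_1,q_1)\times\mathrm O(p-p_1,q-q_1))$ with $p,q,p_1,q_1,p-p_1,q-q_1>0$, let $0\le r\le\min\{p,q\}$, and let $G_0$ be the identity component of $G$. The number $N$ of $(H\cap G_0)$-orbits in an $H$-orbit $\mathcal O(r_U,r_W,a,b_U,b_W)$ in $\mathrm{Gr}_G(r)$ is as follows. (1) $N=4$ if $G=\mathrm O(2a,2a)$, $H=\mathrm O(a,a)\times\mathrm O(a,a)$ and the $H$-orbit is $\mathcal O(0,0,a,0,0)$. (2) $N=2$ in each of the following situations: (2a) $G=\mathrm O(p,2a)$, $H=\mathrm O(p_1,a)\times\mathrm O(p-p_1,a)$, the $H$-orbit is $\mathcal O(0,0,a,0,0)$, and $p_1\ge a$, $p-p_1\ge a$, $p>2a$; (2b) $G=\mathrm O(2a,q)$, $H=\mathrm O(a,q_1)\times\mathrm O(a,q-q_1)$, the $H$-orbit is $\mathcal O(0,0,a,0,0)$, and $q_1\ge a$, $q-q_1\ge a$, $q>2a$; (2c) $G=\mathrm O(p,q)$ with $p=q$, $H=\mathrm O(p_1,q_1)\times\mathrm O(p-p_1,q-q_1)$, the $H$-orbit is $\mathcal O(r_U,r_W,a,b_U,b_W)$ with $r_U+a+b_U=p_1$, $r_W+a+b_W=p-p_1$, $r_U+a+b_W=q_1$, $r_W+a+b_U=q-q_1$, and $r_U+r_W+b_U+b_W>0$. (3) $N=1$ in all other situations.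
   Context: $V=\mathbb R^{p+q}$ has a nondegenerate symmetric bilinear form $B$ of signature $(p,q)$; $V=U\oplus W$ with $U\perp W$, $B|_U$ of signature $(p_1,q_1)$ and $B|_W$ of signature $(p-p_1,q-q_1)$. $G$ is the isometry group of $V$ and $H\subset G$ the product of the isometry groups of $U$ and $W$; the identity component is with respect to the Hausdorff topology ($G$ has 4 connected components). $\mathrm{Gr}_G(r)$ is the variety of $r$-dimensional subspaces $S$ of $V$ with $S\perp S$. For a subspace $X$, $\mathrm{Rad}(X)=X\cap X^\perp$; $\mathbf P_US=(S+W)\cap U$, $\mathbf P_WS=(S+U)\cap W$. For $S\in\mathrm{Gr}_G(r)$: $r_U(S)=\dim(S\cap U)$, $r_W(S)=\dim(S\cap W)$, $a(S)=\dim\frac{\mathrm{Rad}(\mathbf P_US)}{S\cap U}=\dim\frac{\mathrm{Rad}(\mathbf P_WS)}{S\cap W}$, and $b_U(S)$ (resp. $b_W(S)$) is the dimension of a maximal positive definite (resp. negative definite) subspace of $\mathbf P_US$. The 5-tuple $(r_U(S),r_W(S),a(S),b_U(S),b_W(S))$ determines the $H$-orbit of $S$ and has sum $r$; $\mathcal O(r_U,r_W,a,b_U,b_W)$ denotes the $H$-orbit with this 5-tuple. *)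

(* Defs.v *)
From HB Require Import structures.
From mathcomp Require Import all_boot all_order all_algebra.
From mathcomp Require Import all_classical all_reals all_analysis.
Import Order.TTheory GRing.Theory Num.Theory numFieldNormedType.Exports.

Set Implicit Arguments.
Unset Strict Implicit.
Unset Printing Implicit Defensive.

Local Open Scope classical_set_scope.
Local Open Scope ring_scope.

Section Geometry.
Variables (R : realType) (n : nat).
Notation V := 'rV[R]_n.
Variable B : {symmetric V}.
Implicit Types X U W S : {vspace V}.

Definition pos_definite X : Prop := {in X, forall v, v != 0 -> 0 < B v v}.
Definition neg_definite X : Prop := {in X, forall v, v != 0 -> B v v < 0}.

(* The zero subspace is definite of both signs, so these maxima are always
   taken over a nonempty range. *)
Definition pos_dim X : nat :=
  \max_(k < (\dim X).+1 |
    `[< exists P : {vspace V}, [/\ (P <= X)%VS, pos_definite P & \dim P = k] >]) k.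
Definition neg_dim X : nat :=
  \max_(k < (\dim X).+1 |
    `[< exists P : {vspace V}, [/\ (P <= X)%VS, neg_definite P & \dim P = k] >]) k.

Definition has_signature X (p q : nat) : Prop :=
  [/\ (X :&: orthov B X)%VS = 0%VS, pos_dim X = p & neg_dim X = q].

Definition Rad X : {vspace V} := (X :&: orthov B X)%VS.

Definition Gr (r : nat) : set {vspace V} :=
  [set S | \dim S = r /\ (S <= orthov B S)%VS].

(* A matrix g stands for the linear map x |-> x *m g of the row space V. *)
Definition gact (g : 'M[R]_n) S : {vspace V} := (linfun (mulmxr g) @: S)%VS.

Definition isometry_group : set 'M[R]_n :=
  [set g | g \in unitmx /\ isometry B B (mulmxr g)].

(* The entrywise topology on matrices is the Hausdorff topology of the group. *)
Definition identity_component : set 'M[R]_n :=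
  connected_component isometry_group 1%:M.

(* For V the direct sum of U and W: the maps that are the sum of an isometry of
   U and an isometry of W. *)
Definition isometry_prod U W : set 'M[R]_n :=
  [set g | [/\ g \in unitmx, gact g U = U, gact g W = W,
               {in U &, forall u v, B (u *m g) (v *m g) = B u v} &
               {in W &, forall u v, B (u *m g) (v *m g) = B u v}]].

Definition orbit_of (K : set 'M[R]_n) S : set {vspace V} :=
  [set gact g S | g in K].

Definition orbits_in (K : set 'M[R]_n) (O : set {vspace V}) :
    set (set {vspace V}) :=
  [set orbit_of K S | S in O].

(* sproj U W S is the image of S under the projection of V onto U along W. *)
Definition sproj U W S : {vspace V} := ((S + W) :&: U)%VS.

(* The 5-tuple (r_U, r_W, a, b_U, b_W). As S :&: U is contained in
   Rad (sproj U W S), the third entry is the dimension of their quotient. *)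
Definition invariants U W S : nat * nat * nat * nat * nat :=
  (\dim (S :&: U)%VS,
   \dim (S :&: W)%VS,
   (\dim (Rad (sproj U W S)) - \dim (S :&: U)%VS)%N,
   pos_dim (sproj U W S),
   neg_dim (sproj U W S)).

End Geometry.

Definition case1 (p q p1 q1 rU rW a bU bW : nat) : bool :=
  [&& p == (2 * a)%N, q == (2 * a)%N, p1 == a, q1 == a &
      (rU, rW, bU, bW) == (0, 0, 0, 0)%N].

Definition case2a (p q p1 q1 rU rW a bU bW : nat) : bool :=
  [&& q == (2 * a)%N, q1 == a, (rU, rW, bU, bW) == (0, 0, 0, 0)%N,
      (a <= p1)%N, (a <= p - p1)%N & (2 * a < p)%N].

Definition case2b (p q p1 q1 rU rW a bU bW : nat) : bool :=
  [&& p == (2 * a)%N, p1 == a, (rU, rW, bU, bW) == (0, 0, 0, 0)%N,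
      (a <= q1)%N, (a <= q - q1)%N & (2 * a < q)%N].

Definition case2c (p q p1 q1 rU rW a bU bW : nat) : bool :=
  [&& p == q, (rU + a + bU)%N == p1, (rW + a + bW)%N == (p - p1)%N,
      (rU + a + bW)%N == q1, (rW + a + bU)%N == (q - q1)%N &
      (0 < rU + rW + bU + bW)%N].

Definition case2 (p q p1 q1 rU rW a bU bW : nat) : bool :=
  [|| case2a p q p1 q1 rU rW a bU bW, case2b p q p1 q1 rU rW a bU bW |
      case2c p q p1 q1 rU rW a bU bW].

(* Main.v *)
Require Import Defs.
From HB Require Import structures.
From mathcomp Require Import all_boot all_order all_algebra.
From mathcomp Require Import all_classical all_reals all_analysis.
From mathcomp Require Import ring lra zify.
Import Order.TTheory GRing.Theory Num.Theory numFieldNormedType.Exports.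
Local Open Scope classical_set_scope.
Local Open Scope card_scope.
Local Open Scope ring_scope.

(** An isometry g of V has two signs, describing its action on the orientations
    of maximal positive and of maximal negative subspaces. They identify G/G_0
    with (Z/2)^2: G is generated by reflections, reflections in two vectors of
    the same sign are joined by a path, and the signs are locally constant
    because they are signs of nonvanishing determinants det B(m_i g, e_j). As H
    maps onto (Z/2)^2, the orbits of the intersection of H and G_0 on H S are the
    cosets of the image T of the stabilizer of S in H.

    If P_U S or P_W S leaves room for a positive vector of U (resp. W) orthogonal
    to it, the reflection in this vector shows that (1,0) is in T; likewise (0,1)
    for a negative vector. If r_U + r_W + b_U + b_W > 0, then S contains x + y
    with x, y orthogonal of opposite nonzero norms, each in U or in W, and the
    product of their reflections stabilizes S, so (1,1) is in T. Conversely, on an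
    isotropic subspace of dimension p (resp. q) stable under g, the determinant of
    g has the first (resp. second) sign of g. If p = q = r + a, then
    S + Rad (P_U S) serves for both, whence equal signs; if
    r_U = r_W = b_U = b_W = 0, then g acts on S + P_U S = P_U S + P_W S by two
    copies of its action on S, whose determinant is a square. *)

Set Implicit Arguments.
Unset Strict Implicit.
Unset Printing Implicit Defensive.

(** * Symmetric forms and inertia *)

Section Form.
Variables (R : realType) (n : nat) (B : {symmetric 'rV[R]_n}).
Implicit Types (u v w x y : 'rV[R]_n) (X Y P N : {vspace 'rV[R]_n}).

Lemma bformC u v : B u v = B v u.
Proof. by rewrite hermC expr0 mul1r. Qed.
Lemma bformDl u v w : B (u + v) w = B u w + B v w.
Proof. exact: linearDl. Qed.
Lemma bformDr u v w : B w (u + v) = B w u + B w v.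
Proof. exact: linearD. Qed.
Lemma bformZl a u w : B (a *: u) w = a * B u w.
Proof. exact: linearZl_LR. Qed.
Lemma bformZr a u w : B w (a *: u) = a * B w u.
Proof. by rewrite bformC bformZl bformC. Qed.
Lemma bformNl u w : B (- u) w = - B u w.
Proof. by rewrite -scaleN1r bformZl mulN1r. Qed.
Lemma bformNr u w : B w (- u) = - B w u.
Proof. by rewrite -scaleN1r bformZr mulN1r. Qed.
Lemma bform0l w : B 0 w = 0.
Proof. by rewrite -(scale0r 0) bformZl mul0r. Qed.
Lemma bform0r w : B w 0 = 0.
Proof. by rewrite bformC bform0l. Qed.
Lemma bform_suml I r (P : pred I) (F : I -> 'rV[R]_n) w :
  B (\sum_(i <- r | P i) F i) w = \sum_(i <- r | P i) B (F i) w.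
Proof. exact: linear_sumlz. Qed.

(* Negating B swaps the two signs, so that only positive subspaces and positive
   reflections need to be treated. *)
Definition opform u v := - B u v.

Fact opform_bilinear : bilinear_for
  (GRing.Scale.Law.clone _ _ ( *%R) _)
  (GRing.Scale.Law.clone _ _ (idfun \; *%R) _) opform.
Proof.
by split=> [u|u] a x y; rewrite /opform /= ?(bformDl, bformDr, bformZl, bformZr);
  ring.
Qed.
HB.instance Definition _ := bilinear_isBilinear.Build R _ _ _ _ _ opform
  opform_bilinear.
Fact opform_sym u v : opform u v = (-1) ^+ false * idfun (opform v u).
Proof. by rewrite expr0 mul1r /opform bformC. Qed.
HB.instance Definition _ := isHermitianSesquilinear.Build R _ false idfun
  opform opform_sym.
Definition opsym : {symmetric 'rV[R]_n} := opform.

End Form.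

Definition bformE := (bformDl, bformDr, bformZl, bformZr, bformNl, bformNr,
  bform0l, bform0r).

Section Opposite.
Variables (R : realType) (n : nat) (B : {symmetric 'rV[R]_n}).
Implicit Types (u v w x y : 'rV[R]_n) (X Y P N : {vspace 'rV[R]_n}).

Lemma opsymE u v : opsym B u v = - B u v. Proof. by []. Qed.

Lemma orthov_opsym X : orthov (opsym B) X = orthov B X.
Proof.
apply/vspaceP => v; apply/mem_orthovP/mem_orthovP => h w wX;
  by move: (h w wX); rewrite opsymE; lra.
Qed.

Lemma pos_definite_opsym X : pos_definite (opsym B) X = neg_definite B X.
Proof.
by apply/propext; split => h v vX v0; move: (h v vX v0);
  rewrite opsymE oppr_gt0.
Qed.

Lemma neg_definite_opsym X : neg_definite (opsym B) X = pos_definite B X.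
Proof.
by apply/propext; split => h v vX v0; move: (h v vX v0);
  rewrite opsymE oppr_lt0.
Qed.

Lemma pos_dim_opsym X : pos_dim (opsym B) X = neg_dim B X.
Proof.
rewrite /pos_dim /neg_dim; apply: eq_bigl => k; apply: asbool_equiv_eq.
by split=> -[P [? h ?]]; exists P; split; rewrite // ?pos_definite_opsym //
  -pos_definite_opsym.
Qed.

Lemma neg_dim_opsym X : neg_dim (opsym B) X = pos_dim B X.
Proof.
rewrite /pos_dim /neg_dim; apply: eq_bigl => k; apply: asbool_equiv_eq.
by split=> -[P [? h ?]]; exists P; split; rewrite // ?neg_definite_opsym //
  -neg_definite_opsym.
Qed.

Lemma Rad_opsym X : Rad (opsym B) X = Rad B X.
Proof. by rewrite /Rad orthov_opsym. Qed.

End Opposite.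

Section Inertia.
Variables (R : realType) (n : nat).
Implicit Types (B : {symmetric 'rV[R]_n}) (u v w x y : 'rV[R]_n).
Implicit Types (X Y P N Z : {vspace 'rV[R]_n}).

Lemma pos_definite0 B : pos_definite B 0%VS.
Proof. by move=> v; rewrite memv0 => /eqP-> /eqP. Qed.

Lemma pos_dim_max B X P :
  (P <= X)%VS -> pos_definite B P -> (\dim P <= pos_dim B X)%N.
Proof.
move=> sPX dP; have lt : (\dim P < (\dim X).+1)%N by rewrite ltnS dimvS.
apply: (@leq_bigmax_cond _ _ (fun i : 'I_(\dim X).+1 => i : nat) (Ordinal lt)).
by apply/asboolP; exists P.
Qed.

Lemma pos_dim_ex B X :
  exists P, [/\ (P <= X)%VS, pos_definite B P & \dim P = pos_dim B X].
Proof.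
rewrite /pos_dim.
case: (@eq_bigmax_cond _ (fun k : 'I_(\dim X).+1 => `[< exists P : {vspace 'rV[R]_n},
  [/\ (P <= X)%VS, pos_definite B P & \dim P = k] >]) (fun k => k : nat)).
  apply/card_gt0P; exists ord0; apply/asboolP; exists 0%VS.
  by split; [exact: sub0v | exact: pos_definite0 | rewrite dimv0].
by move=> k /asboolP[P [sPX dP Pk]] ->; exists P.
Qed.

Lemma definite_cap0 B P N :
  pos_definite B P -> {in N, forall v, B v v <= 0} -> (P :&: N = 0)%VS.
Proof.
move=> dP dN; apply/eqP; rewrite -subv0; apply/subvP => v.
rewrite memv_cap memv0 => /andP[vP vN]; apply/eqP/eqP/negPn/negP => v0.
by have := dP v vP v0; rewrite ltNge dN.
Qed.

(** The sum is direct, since a common nonzero vector would have both positive and nonpositive norm.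
    Most bounds on signatures below are this count; semidefinite [N] may contain radicals. *)
Lemma dim_definite_add B X P N : (P <= X)%VS -> (N <= X)%VS ->
  pos_definite B P -> {in N, forall v, B v v <= 0} ->
  (\dim P + \dim N <= \dim X)%N.
Proof.
move=> PX NX dP dN; rewrite -dimv_disjoint_sum ?(definite_cap0 dP dN) //.
by apply: dimvS; rewrite subv_add PX.
Qed.

(** Each vector of a basis of [Y] imposes one linear condition on [X], whether or not [B] is
    degenerate. *)
Lemma dim_cap_orthov B X Y : (\dim X <= \dim (X :&: orthov B Y) + \dim Y)%N.
Proof.
rewrite -{1}(span_basis (vbasisP Y)).
suff h (s : seq 'rV[R]_n) : (\dim X <= \dim (X :&: orthov B (span s)) + size s)%N.
  by rewrite (leq_trans (h (vbasis Y))) ?size_tuple.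
elim: s => [|v s IH].
  by rewrite span_nil orthov0 capvf addn0.
rewrite span_cons /= addnS -addSn (leq_trans IH) // leq_add2r.
have -> : (X :&: orthov B (<[v]> + span s) =
   X :&: orthov B (span s) :&: orthov B <[v]>)%VS.
  apply/vspaceP => x; rewrite !memv_cap -andbA; congr andb.
  rewrite !memvE orthovD andbC //.
have := @leq_dim_orthov1 _ _ _ _ B v (X :&: orthov B (span s)).
by rewrite -subn1 leq_subLR add1n.
Qed.

(** Definiteness makes [P] meet its orthogonal trivially, and [dim_cap_orthov] then leaves no room
    outside the sum. *)
Lemma pos_definite_split B X P : (P <= X)%VS -> pos_definite B P ->
  (P + (X :&: orthov B P) = X)%VS.
Proof.
move=> PX dP; apply/eqP; rewrite eqEdim; apply/andP; split.
  by rewrite subv_add; apply/andP; split; rewrite // capvSl.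
rewrite dimv_disjoint_sum; first by rewrite addnC dim_cap_orthov.
apply/eqP; rewrite -subv0; apply/subvP => v; rewrite !memv_cap memv0.
case/and3P=> vP _ /mem_orthovP/(_ v vP) h.
by apply/negPn/negP => v0; have := dP v vP v0; rewrite h ltxx.
Qed.

(** Along the line [w + t *: v] the form is affine in [t] with slope [2 * B v w], so it can stay
    nonpositive only if the slope is zero. *)
Lemma semidefinite_isotropic B Y v w : {in Y, forall x, B x x <= 0} ->
  v \in Y -> w \in Y -> B v v = 0 -> B v w = 0.
Proof.
move=> dY vY wY v0; apply/eqP/negPn/negP => b0.
(* The parameter at which the affine function takes the value 1. *)
pose t := (1 - B w w) / (2 * B v w).
have := dY (w + t *: v) (memvD wY (memvZ t vY)).
rewrite !bformE v0 (bformC B w v).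
have -> : B w w + t * B v w + (t * B v w + t * (t * 0)) = 1.
  by rewrite /t; field.
by rewrite ler10.
Qed.

(** Sylvester's law of inertia. [P] is positive definite of maximal dimension, its orthogonal [Y] in
    [X] is negative semidefinite by maximality, and [N] is a complement in [Y] of the radical of
    [Y], which is also that of [X]. *)
Lemma inertia B X : exists P N, [/\ (P <= X)%VS, (N <= X)%VS,
    pos_definite B P & neg_definite B N] /\
  [/\ \dim P = pos_dim B X, \dim N = neg_dim B X, (N <= orthov B P)%VS &
      (P + N + Rad B X = X)%VS] /\
  \dim X = (pos_dim B X + neg_dim B X + \dim (Rad B X))%N.
Proof.
have [P [PX dP dimP]] := pos_dim_ex B X.
pose Y := (X :&: orthov B P)%VS.
have splitX : (P + Y = X)%VS by apply: pos_definite_split.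
have YX : (Y <= X)%VS by apply: capvSl.
have perpPY x y : x \in P -> y \in Y -> B x y = 0.
  by rewrite memv_cap bformC => xP /andP[_ /mem_orthovP]; apply.
have dY : {in Y, forall x, B x x <= 0}.
  move=> x xY; rewrite leNgt; apply/negP => x0.
  have x_neq0 : x != 0 by apply/eqP => e; rewrite e bform0l ltxx in x0.
  (* A positive [x] in [Y] could be adjoined to [P], against maximality. *)
  have d1 : pos_definite B (P + <[x]>)%VS.
    move=> _ /memv_addP[u uP [_ /vlineP[k ->] ->]] nz.
    rewrite !bformE (bformC B x u) !(perpPY u x) // !mulr0 add0r addr0.
    have [u0|u0] := eqVneq u 0.
      rewrite u0 add0r scaler_eq0 negb_or in nz; case/andP: nz => k0 _.
      by rewrite u0 bform0l add0r mulrA -expr2 mulr_gt0 // exprn_even_gt0.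
    by rewrite ltr_pwDl ?dP // mulrA -expr2 mulr_ge0 ?sqr_ge0 // ltW.
  have : (\dim (P + <[x]>) <= pos_dim B X)%N.
    apply: pos_dim_max => //; rewrite subv_add; apply/andP; split=> //.
    by rewrite -memvE (subvP YX).
  rewrite dimv_disjoint_sum ?dim_vline ?x_neq0 ?dimP ?addn1 ?ltnn //.
  apply/eqP; rewrite -subv0; apply/subvP => v; rewrite memv_cap memv0.
  case/andP=> vP /vlineP[k vk]; apply/negPn/negP => v0.
  by have := dP v vP v0; rewrite {2}vk bformZr perpPY // mulr0 ltxx.
have RadE : Rad B X = Rad B Y.
  apply/vspaceP => v; rewrite !memv_cap; apply/idP/idP.
    case/andP=> vX /mem_orthovP vo; rewrite vX /=; apply/andP; split.
      by apply/mem_orthovP => w wP; apply: vo; rewrite (subvP PX).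
    by apply/mem_orthovP => w wY; apply: vo; rewrite (subvP YX).
  case/andP=> /andP[vX /mem_orthovP vP] /mem_orthovP vY; rewrite vX.
  apply/mem_orthovP => w; rewrite -splitX => /memv_addP[a aP [b bY ->]].
  by rewrite bformDr vP // vY // addr0.
pose N := (Y :\: Rad B Y)%VS.
have NY : (N <= Y)%VS by apply: diffvSl.
have splitY : (N + Rad B Y = Y)%VS.
  by rewrite -{2}(addv_diff_cap Y (Rad B Y)); congr addv;
    rewrite /Rad capvA capvv.
have dN : neg_definite B N.
  move=> v vN v0; have vY := subvP NY _ vN; rewrite lt_neqAle dY // andbT.
  apply/eqP => vv; move/negP: v0; apply.
  rewrite -memv0 -(capv_diff Y (Rad B Y)) memv_cap vN memv_cap vY.
  by apply/mem_orthovP => w wY; apply: (semidefinite_isotropic dY).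
have NX := subv_trans NY YX.
have dimX : \dim X = (\dim P + \dim N + \dim (Rad B X))%N.
  rewrite -{1}splitX dimv_disjoint_sum ?(definite_cap0 dP dY) //.
  rewrite -{1}splitY dimv_disjoint_sum -?RadE ?addnA //.
  by rewrite RadE capv_diff.
(* [N] is maximal: a negative definite [M] meets the positive semidefinite [P + Rad B X] trivially,
   which bounds its dimension by that of [N]. *)
have dimN : \dim N = neg_dim B X.
  apply/eqP; rewrite eqn_leq -pos_dim_opsym; apply/andP; split.
    by apply: pos_dim_max => //; rewrite pos_definite_opsym.
  have [M [MX dM <-]] := pos_dim_ex (opsym B) X.
  have : (\dim M + \dim (P + Rad B X) <= \dim X)%N.
    apply: (dim_definite_add (B := opsym B)) => //.
      by rewrite subv_add; apply/andP; split=> //; exact: capvSl.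
    move=> v /memv_addP[a aP [b + ->]]; rewrite memv_cap => /andP[bX /mem_orthovP bo].
    rewrite opsymE oppr_le0 !bformE (bformC B a b) (bo b) // (bo a) ?(subvP PX) // ?addr0 ?add0r.
    by have [->|a0] := eqVneq a 0; rewrite ?bform0l // ltW // dP.
  rewrite dimv_disjoint_sum; first lia.
  apply/eqP; rewrite -subv0; apply/subvP => v; rewrite !memv_cap memv0.
  case/and3P => vP vX /mem_orthovP/(_ v vX) vv; apply/negPn/negP => v0.
  by have := dP v vP v0; rewrite vv ltxx.
exists P, N; split; [by split | split; last by rewrite -dimP -dimN].
split=> //; first by apply: subv_trans NY (capvSr _ _).
by rewrite -addvA RadE splitY splitX.
Qed.

End Inertia.

(** * Components of the isometry group *)

Section MatrixContinuity.
Variable R : realType.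

Lemma cvg_mx (T : Type) (F : set_system T) (m n : nat) (f : T -> 'M[R]_(m, n))
    (M : 'M[R]_(m, n)) : Filter F ->
  (forall i j, f x i j @[x --> F] --> M i j) -> f x @[x --> F] --> M.
Proof.
move=> FF h A [P MP PA].
have Q : F [set x | forall i j, P i j (f x i j)].
  by apply: filter_forall => i; apply: filter_forall => j; exact: (h i j _ (MP i j)).
by apply: filterS Q => x; exact: PA.
Qed.

Lemma continuous_at_mx (T : topologicalType) (m n : nat) (f : T -> 'M[R]_(m, n))
    (x : T) : (forall i j, {for x, continuous (fun y => f y i j)}) ->
  {for x, continuous f}.
Proof. by move=> h; apply: cvg_mx => i j; exact: h. Qed.

Lemma continuous_mx (T : topologicalType) (m n : nat) (f : T -> 'M[R]_(m, n)) :
  (forall i j, continuous (fun x => f x i j)) -> continuous f.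
Proof. by move=> h x; apply: continuous_at_mx => i j; exact: h. Qed.

Lemma continuous_mul (T : topologicalType) (f g : T -> R) :
  continuous f -> continuous g -> continuous (fun x => f x * g x).
Proof. by move=> cf cg x; apply: cvgM; [exact: cf | exact: cg]. Qed.

Lemma continuous_sum (T : topologicalType) (I : Type) (r : seq I) (P : pred I)
    (F : I -> T -> R) : (forall i, continuous (F i)) ->
  continuous (fun x => \sum_(i <- r | P i) F i x).
Proof. by move=> h; apply: continuous_big => [|i _]; [exact: add_continuous | exact: h]. Qed.

Lemma continuous_prod (T : topologicalType) (I : Type) (r : seq I) (P : pred I)
    (F : I -> T -> R) : (forall i, continuous (F i)) ->
  continuous (fun x => \prod_(i <- r | P i) F i x).
Proof. by move=> h; apply: continuous_big => [|i _]; [exact: mul_continuous | exact: h]. Qed.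

Lemma continuous_det (T : topologicalType) (k : nat) (f : T -> 'M[R]_k) :
  (forall i j, continuous (fun x => f x i j)) -> continuous (fun x => \det (f x)).
Proof.
move=> h; apply: continuous_sum => s; apply: continuous_mul.
  by move=> x; exact: cvg_cst.
by apply: continuous_prod => i; exact: h.
Qed.

Lemma continuous_mulmx_coord (k l m n : nat) (a : 'M[R]_(k, l))
    (b : 'M[R]_(m, n)) i j : continuous (fun g => (a *m g *m b) i j).
Proof.
under eq_fun do rewrite mxE.
apply: continuous_sum => c; apply: continuous_mul; last exact: cst_continuous.
under eq_fun do rewrite mxE.
apply: continuous_sum => d; apply: continuous_mul; first exact: cst_continuous.
exact: coord_continuous.
Qed.

Lemma continuous_mulmx2 (k l m n : nat) (a : 'M[R]_(k, l)) (b : 'M[R]_(m, n)) :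
  continuous (fun g => a *m g *m b).
Proof. by apply: continuous_mx => i j; exact: continuous_mulmx_coord. Qed.

(** Intermediate values: the image of [A] is an interval that misses 0. *)
Lemma connected_same_sign (T : topologicalType) (A : set T) (f : T -> R) x y :
  connected A -> continuous f -> (forall z, A z -> f z != 0) -> A x -> A y ->
  0 < f x * f y.
Proof.
move=> cA cf f0 Ax Ay.
have /connected_intervalP itv : connected (f @` A).
  apply: connected_continuous_connected => //; exact: continuous_subspaceT.
have no0 : ~ (f @` A) 0 by case=> z /f0 /eqP.
have fx : (f @` A) (f x) by exists x.
have fy : (f @` A) (f y) by exists y.
rewrite ltNge; apply/negP => le0; apply: no0.
have [x0|x0] := leP 0 (f x).
  apply: (itv (f y) (f x)) => //; rewrite x0 andbT.
  have x1 : 0 < f x by rewrite lt_neqAle eq_sym (f0 x Ax).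
  by move: le0; rewrite pmulr_rle0.
apply: (itv (f x) (f y)) => //; rewrite ltW //=.
by move: le0; rewrite nmulr_rle0.
Qed.

Section FormDet.
Variables (n k : nat) (B : {symmetric 'rV[R]_n}) (m e : 'I_k -> 'rV[R]_n).

(** Pairs the images of the [m i] under [g] with a fixed test family [e]; the sign of the
    determinant compares orientations. *)
Definition form_mx (g : 'M[R]_n) := \matrix_(i, j) B (m i *m g) (e j).

(** Each entry is linear in [g]: a row times [g] times the column of the values of [B] at the
    standard basis and [e j]. *)
Lemma continuous_form_mx i j : continuous (fun g => form_mx g i j).
Proof.
have h g : form_mx g i j =
  ((m i *m g *m (\col_l B (delta_mx 0 l) (e j))) : 'M[R]_1) 0 0.
  rewrite mxE [in LHS](row_sum_delta (m i *m g)) bform_suml mxE.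
  by apply: eq_bigr => l _; rewrite bformZl [X in _ = _ * X]mxE.
under eq_fun do rewrite h.
exact: continuous_mulmx_coord.
Qed.

Lemma form_det_same_sign A g h : connected A ->
  (forall x, A x -> \det (form_mx x) != 0) -> A g -> A h ->
  0 < \det (form_mx g) * \det (form_mx h).
Proof.
move=> cA nz; apply: (connected_same_sign cA _ nz).
exact: continuous_det continuous_form_mx.
Qed.

End FormDet.
End MatrixContinuity.

(** * Isometries, their connected components, and reflections *)

Section IsometryGroup.
Variables (R : realType) (n : nat) (B : {symmetric 'rV[R]_n}).
Implicit Types (u v w x y : 'rV[R]_n) (g h k : 'M[R]_n).

Notation iso := (isometry_group B).

Lemma isoB g u v : iso g -> B (u *m g) (v *m g) = B u v.
Proof. by case=> _; apply. Qed.

Lemma iso_unit g : iso g -> g \in unitmx. Proof. by case. Qed.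

Lemma iso1 : iso 1%:M.
Proof. by split=> [|u v]; rewrite ?unitmx1 //= !mulmx1. Qed.

Lemma isoM g h : iso g -> iso h -> iso (g *m h).
Proof.
move=> ig ih; split=> [|u v]; first by rewrite unitmx_mul !iso_unit.
by rewrite /= !mulmxA !isoB.
Qed.

Lemma isoV g : iso g -> iso (invmx g).
Proof.
move=> ig; have ug := iso_unit ig; split=> [|u v]; first by rewrite unitmx_inv.
by rewrite -(isoB _ _ ig) /= !mulmxKV.
Qed.

Definition same_component g h := connected_component iso g h.
Notation "g ~~ h" := (same_component g h) (at level 70).

Lemma same_component_refl g : iso g -> g ~~ g.
Proof. exact: connected_component_refl. Qed.

Lemma same_component_sym g h : g ~~ h -> h ~~ g.
Proof. exact: connected_component_sym. Qed.

Lemma same_component_trans h g k : g ~~ h -> h ~~ k -> g ~~ k.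
Proof. exact: connected_component_trans. Qed.

Lemma same_componentP g h : g ~~ h <->
  exists A, [/\ connected A, A `<=` iso, A g & A h].
Proof. by split=> [[A [? ? ?] ?]|[A [? ? ? ?]]]; exists A. Qed.

Lemma same_component_isol g h : g ~~ h -> iso g.
Proof. by case/same_componentP=> A [_ + + _]; apply. Qed.

Lemma same_component_isor g h : g ~~ h -> iso h.
Proof. by case/same_componentP=> A [_ + _]; apply. Qed.

(** Multiplication by a fixed isometry on either side is continuous: first [g] is moved to [g'] with
    [h] fixed, then [h] to [h'] with [g'] fixed. *)
Lemma same_componentM g g' h h' : g ~~ g' -> h ~~ h' -> g *m h ~~ g' *m h'.
Proof.
move=> gg hh; have ig' := same_component_isor gg.
have ih := same_component_isol hh.
apply: (same_component_trans (h := g' *m h)).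
  case/same_componentP: gg => A [cA Ai Ag Ag']; apply/same_componentP.
  exists ((fun a : 'M[R]_n => 1%:M *m a *m h) @` A); split.
  - apply: connected_continuous_connected => //.
    by apply: continuous_subspaceT; exact: continuous_mulmx2.
  - by move=> _ [x /Ai ix <-]; rewrite mul1mx; exact: isoM.
  - by exists g; rewrite ?mul1mx.
  - by exists g'; rewrite ?mul1mx.
case/same_componentP: hh => A [cA Ai Ah Ah']; apply/same_componentP.
exists ((fun a : 'M[R]_n => g' *m a *m 1%:M) @` A); split.
- apply: connected_continuous_connected => //.
  by apply: continuous_subspaceT; exact: continuous_mulmx2.
- by move=> _ [x /Ai ix <-]; rewrite mulmx1; exact: isoM.
- by exists h; rewrite ?mulmx1.
- by exists h'; rewrite ?mulmx1.
Qed.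

(** The column lists the values of [B] at the standard basis and [v]. For isotropic [v] the quotient
    by zero is zero and the matrix is the identity. *)
Definition reflection v : 'M[R]_n :=
  1%:M - (2 / B v v) *: ((\col_l B (delta_mx 0 l) v) *m v).

Lemma mulmx_reflection x v :
  x *m reflection v = x - (2 * B x v / B v v) *: v.
Proof.
rewrite mulmxBr mulmx1 -scalemxAr mulmxA.
have -> : x *m (\col_l B (delta_mx 0 l) v) = (B x v)%:M.
  apply/matrixP => i j; rewrite !ord1 !mxE eqxx mulr1n.
  rewrite [in RHS](row_sum_delta x) bform_suml.
  by apply: eq_bigr => l _; rewrite bformZl mxE.
rewrite mul_scalar_mx scalerA; congr (_ - _ *: _); ring.
Qed.

Lemma reflection_fix x v : B x v = 0 -> x *m reflection v = x.
Proof. by move=> h; rewrite mulmx_reflection h mulr0 mul0r scale0r subr0. Qed.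

Lemma reflection_self v : B v v != 0 -> v *m reflection v = - v.
Proof.
move=> h; rewrite mulmx_reflection mulfK // scaler_nat mulr2n; apply/rowP => i.
by rewrite !mxE; ring.
Qed.

Lemma reflectionK v : B v v != 0 -> reflection v *m reflection v = 1%:M.
Proof.
move=> h; apply/row_matrixP => i; rewrite !rowE mulmx1 mulmxA.
move: (delta_mx 0 i) => x; rewrite [in LHS]mulmx_reflection mulmx_reflection.
rewrite !bformE; apply/rowP => j; rewrite !mxE; field; exact: h.
Qed.

Lemma reflection_iso v : B v v != 0 -> iso (reflection v).
Proof.
move=> h; split=> [|x y].
  by have [] := mulmx1_unit (reflectionK h).
rewrite /= !mulmx_reflection !bformE (bformC B v y); field; exact: h.
Qed.

Lemma reflectionN v : reflection (- v) = reflection v.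
Proof.
apply/row_matrixP => i; rewrite !rowE !mulmx_reflection !bformE opprK.
by rewrite mulrN mulNr scaleNr scalerN opprK.
Qed.

Lemma reflection_formC x y v :
  B (x *m reflection v) y = B x (y *m reflection v).
Proof. by rewrite !mulmx_reflection !bformE (bformC B v y); ring. Qed.

Lemma reflection_commute v w : B v w = 0 ->
  reflection v *m reflection w = reflection w *m reflection v.
Proof.
move=> h; apply/row_matrixP => i; rewrite !rowE !mulmxA !mulmx_reflection.
rewrite !bformE (bformC B w v) h !mulr0 !subr0.
by apply/rowP => j; rewrite !mxE; ring.
Qed.

End IsometryGroup.

(** * Paths of reflections and generation of the isometry group *)

Section Reflections.
Variables (R : realType) (n : nat).
Implicit Types (B : {symmetric 'rV[R]_n}) (u v w x y : 'rV[R]_n).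
Implicit Types (g h k : 'M[R]_n) (X : {vspace 'rV[R]_n}).

Lemma orthov_eq0 B X x y : x \in orthov B X -> y \in X -> B x y = 0.
Proof. by move=> /mem_orthovP; apply. Qed.

Lemma isometry_group_opsym B : isometry_group (opsym B) = isometry_group B.
Proof.
apply/seteqP; split=> g [ug ig]; split=> // u v.
  by have := ig u v; rewrite /= !opsymE => /oppr_inj.
by rewrite !opsymE /= (ig u v).
Qed.

Lemma same_component_opsym B g h :
  same_component (opsym B) g h = same_component B g h.
Proof. by rewrite /same_component isometry_group_opsym. Qed.

Lemma reflection_opsym B v : reflection (opsym B) v = reflection B v.
Proof.
apply/row_matrixP => i; rewrite !rowE !mulmx_reflection !opsymE.
by rewrite mulrN invrN mulrNN.
Qed.

Lemma continuous_interpolate (f g : R -> R) : continuous f -> continuous g ->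
  continuous (fun t : R => t * f t + (1 - t) * g t).
Proof.
move=> cf cg t; apply: cvgD; apply: cvgM; [exact: cvg_id| exact: cf| |exact: cg].
by apply: cvgB; [exact: cvg_cst | exact: cvg_id].
Qed.

Lemma reflection_same_component B v w : 0 < B v v -> 0 < B w w ->
  same_component B (reflection B v) (reflection B w).
Proof.
(* Replacing [w] by [- w] leaves its reflection unchanged. With [B v w] nonnegative, the norm is
   positive along the whole segment from [w] to [v], whose reflections form the path. *)
move=> v0; wlog vw : w / 0 <= B v w => [hw w0|w0].
  have [h|h] := leP 0 (B v w); first exact: hw.
  by rewrite -(reflectionN B w); apply: hw; rewrite ?bformE ?opprK // oppr_ge0 ltW.
pose c (t : R) := t *: v + (1 - t) *: w.
have cc t : 0 <= t <= 1 -> 0 < B (c t) (c t).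
  case/andP=> t0 t1; rewrite /c !bformE (bformC B w v).
  have [->|tn] := eqVneq t 1; first by nra.
  have t1' : 0 < (1 - t) * (1 - t) by rewrite mulr_gt0 // subr_gt0 lt_neqAle tn.
  have := mulr_gt0 t1' w0.
  have : 0 <= t * t * B v v by rewrite !mulr_ge0 // ltW.
  have : 0 <= t * (1 - t) * B v w by rewrite !mulr_ge0 // subr_ge0.
  by nra.
apply/same_componentP; exists ((fun t : R => reflection B (c t)) @` `[0, 1]); split.
- apply: connected_continuous_connected; first exact: segment_connected.
  apply: continuous_in_subspaceT => t; rewrite inE /= in_itv /= => /cc ct.
  apply: continuous_at_mx => i j.
  have -> : (fun t : R => reflection B (c t) i j) =
    (fun t : R => (1%:M : 'M[R]_n) i j - 2 *
      ((B (c t) (c t))^-1 * (B (delta_mx 0 i) (c t) * c t 0 j))).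
    by apply/funext => s; rewrite !mxE big_ord1 !mxE; ring.
  have c_cst (a : R) : continuous (fun _ : R => a) by move=> ?; exact: cvg_cst.
  have cB u : continuous (fun t : R => B u (c t)).
    under eq_fun do rewrite /c !bformE.
    exact: (continuous_interpolate (c_cst _) (c_cst _)).
  have cBB : continuous (fun t : R => B (c t) (c t)).
    have -> : (fun t : R => B (c t) (c t)) =
        (fun t : R => t * B v (c t) + (1 - t) * B w (c t)).
      by apply/funext => s; rewrite {1}/c !bformDl !bformZl.
    exact: (continuous_interpolate (cB _) (cB _)).
  have cj : continuous (fun t : R => c t 0 j).
    under eq_fun do rewrite /c !mxE.
    exact: (continuous_interpolate (c_cst _) (c_cst _)).
  apply: cvgB; first exact: cvg_cst.
  apply: cvgM; first exact: cvg_cst.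
  apply: cvgM; [apply: cvgV; first by rewrite gt_eqF | apply: cvgM].
  + exact: cBB.
  + exact: cB.
  + exact: cj.
- move=> _ [t /= + <-]; rewrite in_itv /= => /cc ct.
  by apply: reflection_iso; rewrite gt_eqF.
- exists 1; first by rewrite /= in_itv /= ler01 lexx.
  by rewrite /c scale1r subrr scale0r addr0.
- exists 0; first by rewrite /= in_itv /= ler01 lexx.
  by rewrite /c scale0r subr0 scale1r add0r.
Qed.

(** If all norms on [X] vanish, polarization makes [B] vanish on [X], which is then its own
    radical. *)
Lemma exists_anisotropic B X : X != 0%VS -> (X :&: orthov B X = 0)%VS ->
  exists2 e, e \in X & B e e != 0.
Proof.
move=> X0 nd; apply: contrapT => no.
have iso0 e : e \in X -> B e e = 0.
  by move=> eX; apply/eqP/negPn/negP => h; apply: no; exists e.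
case/negP: X0; rewrite -subv0 -nd; apply/subvP => y yX; rewrite memv_cap yX.
apply/mem_orthovP => x xX; have := iso0 _ (memvD xX yX).
by rewrite !bformE !iso0 // (bformC B x y); lra.
Qed.

(* Weak Cartan-Dieudonne: for e orthogonal to a fixed nondegenerate subspace,
   either the reflection in e g - e maps e g to e, or the reflection in e g + e
   followed by that in e does. *)
Lemma isometry_group_ind B (P : 'M[R]_n -> Prop) : nondegenerate B ->
  P 1%:M ->
  (forall v g, B v v != 0 -> isometry_group B g -> P g -> P (g *m reflection B v)) ->
  forall g, isometry_group B g -> P g.
Proof.
move=> ndB P1 Pref.
(* Induction on the codimension of a nondegenerate subspace [X] that [g] fixes pointwise, starting
   from the zero subspace. *)
suff hX m X g : (n - \dim X < m)%N -> (X :&: orthov B X = 0)%VS ->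
    (forall x, x \in X -> x *m g = x) -> isometry_group B g -> P g.
  move=> g ig; apply: (hX (n - 0).+1 0%VS) => //; rewrite ?dimv0 ?cap0v //.
  by move=> x; rewrite memv0 => /eqP->; rewrite mul0mx.
elim: m X g => // m IH X g lt ndX fixX ig.
have dimn : \dim (fullv : {vspace 'rV[R]_n}) = n by rewrite dimvf; apply: mul1n.
have [Xf|Xf] := eqVneq X fullv.
  have -> // : g = 1%:M.
  by apply/row_matrixP => i; rewrite !rowE mulmx1 fixX // Xf memvf.
have dimX : (\dim X < n)%N.
  by rewrite ltnNge; apply: contraNN Xf => h; rewrite eqEdim subvf dimn.
have := dim_cap_orthov B fullv X; rewrite capfv dimn => dimo.
have Vsum : (X + orthov B X = fullv)%VS.
  by apply/eqP; rewrite eqEdim subvf dimn dimv_disjoint_sum // addnC.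
have [||e eX e0] := @exists_anisotropic B (orthov B X).
- by rewrite -dimv_eq0; lia.
- apply/eqP; rewrite -subv0; apply/subvP => y; rewrite memv_cap.
  case/andP=> yX /mem_orthovP yo; rewrite -(eqP ndB).
  apply/mem_orthovP => z _.
  have /memv_addP[a aX [b bX ->]] : z \in (X + orthov B X)%VS by rewrite Vsum memvf.
  by rewrite bformDr (orthov_eq0 yX aX) yo // addr0.
have perp x : x \in X -> B x e = 0.
  by move=> xX; rewrite bformC (orthov_eq0 eX).
pose f := e *m g; have fe : B f f = B e e by rewrite isoB.
have perpf x : x \in X -> B x f = 0.
  by move=> xX; rewrite -(perp x xX) -{1}(fixX x xX) isoB.
(* An isometry that fixes [e] as well fixes the larger nondegenerate subspace [X + <[e]>], so the
   induction hypothesis applies. *)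
have step h : isometry_group B h -> (forall x, x \in X -> x *m h = x) ->
    e *m h = e -> P h.
  move=> ih fixh eh.
  have eX' : e \notin X by apply/negP => /perp /eqP; apply/negP.
  apply: (IH (X + <[e]>)%VS) => //.
  - rewrite dimv_disjoint_sum ?dim_vline; last first.
      apply/eqP; rewrite -subv0; apply/subvP => y; rewrite memv_cap memv0.
      case/andP=> yX /vlineP[c yc]; have := perp y yX; rewrite yc bformZl => /eqP.
      by rewrite mulf_eq0 (negPf e0) orbF => /eqP->; rewrite scale0r.
    by have -> : e != 0; [apply: contraNneq e0 => ->; rewrite bform0l | lia].
  - apply/eqP; rewrite -subv0; apply/subvP => y; rewrite memv_cap.
    case/andP=> /memv_addP[a aX [_ /vlineP[c ->] ->]] /mem_orthovP yo.
    have : B (a + c *: e) e = 0 by apply: yo; rewrite (subvP (addvSr _ _)) ?memv_line.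
    rewrite !bformE perp // add0r => /eqP; rewrite mulf_eq0 (negPf e0) orbF => /eqP c0.
    rewrite c0 scale0r addr0 -ndX memv_cap aX; apply/mem_orthovP => x xX.
    have : B (a + c *: e) x = 0 by apply: yo; rewrite (subvP (addvSl _ _)).
    by rewrite c0 scale0r addr0.
  - move=> y /memv_addP[a aX [_ /vlineP[c ->] ->]].
    by rewrite mulmxDl -scalemxAl eh fixh.
have undo v h : B v v != 0 -> isometry_group B h -> P (h *m reflection B v) -> P h.
  move=> v0 ih Ph; rewrite -(mulmx1 h) -(reflectionK v0) mulmxA.
  by apply: Pref => //; apply: isoM => //; apply: reflection_iso.
have [h0|h0] := eqVneq (B (f - e) (f - e)) 0; last first.
  apply: (undo (f - e)) => //; apply: step.
  - by apply: isoM => //; apply: reflection_iso.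
  - move=> x xX; rewrite mulmxA fixX // reflection_fix // bformE bformNr.
    by rewrite perpf // perp // subr0.
  - rewrite mulmxA -/f mulmx_reflection.
    have -> : 2 * B f (f - e) / B (f - e) (f - e) = 1.
      apply: (canLR (mulfK h0)); rewrite !bformE fe (bformC B e f); ring.
    by rewrite scale1r opprB addrC subrK.
(* The norms of [f - e] and [f + e] add up to [4 * B e e], so they cannot both vanish. *)
have fe0 : B (f + e) (f + e) != 0.
  move: h0; rewrite !bformE fe (bformC B e f) => h0.
  have -> : B e e + B f e + (B f e + B e e) = 4 * B e e by lra.
  by rewrite mulf_neq0.
apply: (undo (f + e)) => //; apply: (undo e) => //.
  by apply: isoM => //; apply: reflection_iso.
apply: step.
- by do 2![apply: isoM => //; last exact: reflection_iso].
- move=> x xX; rewrite !mulmxA fixX // !reflection_fix ?perp //;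
    by rewrite bformDr perpf // perp // addr0.
- rewrite !mulmxA -/f [f *m _]mulmx_reflection.
  have -> : 2 * B f (f + e) / B (f + e) (f + e) = 1.
    apply: (canLR (mulfK fe0)); rewrite !bformE fe (bformC B e f); ring.
  by rewrite scale1r opprD addrA subrr add0r mulNmx reflection_self // opprK.
Qed.

End Reflections.

(** * Frames and determinants that detect orientation *)

Section Frames.
Variables (R : realType) (n : nat).
Implicit Types (B : {symmetric 'rV[R]_n}) (u v w x y : 'rV[R]_n).
Implicit Types (g h k : 'M[R]_n) (X P : {vspace 'rV[R]_n}).

(** Intended for a basis [e] of a maximal positive definite subspace, whose orthogonal is negative
    definite when [B] is nondegenerate. *)
Definition negative_off B (p : nat) (e : 'I_p -> 'rV[R]_n) :=
  forall x, x != 0 -> (forall i, B x (e i) = 0) -> B x x < 0.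

Definition isotropic_free B (p : nat) (m : 'I_p -> 'rV[R]_n) :=
  (forall c : 'rV[R]_p, c != 0 -> \sum_i c 0 i *: m i != 0) /\
  (forall i j, B (m i) (m j) = 0).

Lemma free_nth_sum p (s : seq 'rV[R]_n) (c : 'rV[R]_p) :
  free s -> size s = p -> c != 0 -> \sum_i c 0 i *: s`_i != 0.
Proof.
move=> frees sizes; apply: contraNneq => h; apply/eqP/rowP => i; rewrite mxE.
have /freeP ft : free (Tuple (introT eqP sizes)) by [].
exact: (ft (c 0) h i).
Qed.

(* A nonzero vector orthogonal to all the e j is negative, which the image of a
   nonnegative combination of the m i cannot be; hence the sign of this
   determinant is constant on each component. *)
Lemma form_mx_det_neq0 B p (m e : 'I_p -> 'rV[R]_n) g :
  negative_off B e ->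
  (forall c : 'rV[R]_p, c != 0 -> \sum_i c 0 i *: m i != 0) ->
  (forall c : 'rV[R]_p, 0 <= B (\sum_i c 0 i *: m i) (\sum_i c 0 i *: m i)) ->
  isometry_group B g -> \det (form_mx B m e g) != 0.
Proof.
move=> neg free nonneg ig; apply/det0P => -[c c0 ce0].
pose y := \sum_i c 0 i *: m i.
have yg0 : y *m g != 0.
  apply: contraNneq (free c c0) => h.
  by rewrite -/y -(mulmxK (iso_unit ig) y) h mul0mx.
suff /(neg _ yg0) : forall j, B (y *m g) (e j) = 0.
  by rewrite isoB // ltNge nonneg.
move=> j; have /rowP/(_ j) := ce0; rewrite !mxE => <-.
rewrite mulmx_suml bform_suml; apply: eq_bigr => i _.
by rewrite mxE -scalemxAl bformZl.
Qed.

(** A reflection is self-adjoint, so it can be moved onto the test family, where it negates [e i0]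
    and fixes the other members: one column changes sign. *)
Lemma form_mx_reflection_det B p (m e : 'I_p -> 'rV[R]_n) i0 g :
  B (e i0) (e i0) != 0 -> (forall i, i != i0 -> B (e i) (e i0) = 0) ->
  \det (form_mx B m e (g *m reflection B (e i0))) = - \det (form_mx B m e g).
Proof.
move=> e0 orth.
pose d : 'rV[R]_p := \row_j (if j == i0 then -1 else 1).
have -> : form_mx B m e (g *m reflection B (e i0)) = form_mx B m e g *m diag_mx d.
  apply/matrixP => i j; rewrite mul_mx_diag !mxE mulmxA reflection_formC.
  case: eqP => [->|/eqP h]; first by rewrite reflection_self // bformNr mulrN1.
  by rewrite reflection_fix ?orth // mulr1.
rewrite det_mulmx det_diag (bigD1 i0) //= mxE eqxx big1 ?mulr1 ?mulrN1 //.
by move=> i /negPf ii; rewrite mxE ii.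
Qed.

Lemma form_mx_reflection_det_id B p (m e : 'I_p -> 'rV[R]_n) v g :
  (forall i, B (e i) v = 0) ->
  \det (form_mx B m e (g *m reflection B v)) = \det (form_mx B m e g).
Proof.
move=> orth; congr (\det _); apply/matrixP => i j.
by rewrite !mxE mulmxA reflection_formC reflection_fix.
Qed.

(** A nonnegative [x] orthogonal to [X] would make [X + <[x]>] positive semidefinite, too large to
    avoid a maximal negative definite subspace. *)
Lemma pos_definite_max_orthov B X : nondegenerate B ->
  pos_definite B X -> \dim X = pos_dim B fullv ->
  forall x, x != 0 -> x \in orthov B X -> B x x < 0.
Proof.
move=> ndB dX dimX x x0 xX; rewrite ltNge; apply/negP => xx.
have [P [N [[_ _ _ dN] [[_ dimN _ _] dimV]]]] := inertia B fullv.
move: dimV; rewrite /Rad capfv (eqP ndB) dimv0 addn0 -dimX -dimN.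
have : (\dim N + \dim (X + <[x]>) <= \dim (fullv : {vspace 'rV[R]_n}))%N.
  apply: (dim_definite_add (B := opsym B)); rewrite ?subvf //.
    by rewrite pos_definite_opsym.
  move=> z /memv_addP[a aX [_ /vlineP[c ->] ->]].
  rewrite opsymE oppr_le0 !bformE (bformC B a x) (orthov_eq0 xX aX).
  have cc : 0 <= c * (c * B x x) by rewrite mulrA -expr2 mulr_ge0 ?sqr_ge0.
  rewrite !mulr0 addr0 add0r addr_ge0 //.
  by have [->|a0] := eqVneq a 0; rewrite ?bform0l // ltW // dX.
rewrite [X in (_ + X)%N]dimv_disjoint_sum ?dim_vline ?x0; first by lia.
apply/eqP; rewrite -subv0; apply/subvP => y; rewrite memv_cap memv0.
case/andP=> yX /vlineP[c yc]; apply/negPn/negP => y0.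
by have := dX y yX y0; rewrite {1}yc bformZl (orthov_eq0 xX yX) mulr0 ltxx.
Qed.

(** The orthogonal of [v] is nondegenerate and loses one dimension. Since [v] can be adjoined to any
    of its negative definite subspaces, the loss is on the negative side. *)
Lemma pos_dim_orthov_neg B v : nondegenerate B -> B v v < 0 ->
  (pos_dim B fullv <= pos_dim B (orthov B <[v]>))%N.
Proof.
move=> ndB v0.
have [_ [_ [_ [_]]]] := inertia B fullv.
rewrite /Rad capfv (eqP ndB) dimv0 addn0 => dimV.
have [_ [_ [_ [_]]]] := inertia B (orthov B <[v]>).
have -> : Rad B (orthov B <[v]>) = 0%VS.
  apply/eqP; rewrite -subv0; apply/subvP => x; rewrite memv_cap -(eqP ndB).
  case/andP=> xv xY; apply/mem_orthovP => z _.
  pose c := B z v / B v v; rewrite -(subrK (c *: v) z) bformDr.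
  have -> : B x (c *: v) = 0.
    by rewrite bformZr (orthov_eq0 xv (memv_line v)) mulr0.
  rewrite (orthov_eq0 xY) ?addr0 //; rewrite mem_orthov1 !bformE /c.
  by rewrite divfK ?subrr // lt_eqF.
rewrite dimv0 addn0 => dimY.
have := dim_cap_orthov B fullv <[v]>%VS; rewrite capfv dim_vline.
have -> : v != 0 by apply/eqP => e; rewrite e bform0l ltxx in v0.
rewrite dimV dimY.
have [N [NY dN dimN]] := pos_dim_ex (opsym B) (orthov B <[v]>).
suff : (neg_dim B (orthov B <[v]>) + 1 <= neg_dim B fullv)%N by lia.
rewrite -(pos_dim_opsym B fullv) -(pos_dim_opsym B (orthov _ _)) -dimN.
have v_neq0 : v != 0 by apply/eqP => e; rewrite e bform0l ltxx in v0.
have oNv y : y \in N -> B y v = 0.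
  by move=> /(subvP NY) /orthov_eq0; apply; exact: memv_line.
have <- : \dim (N + <[v]>)%VS = (\dim N + 1)%N.
  rewrite dimv_disjoint_sum ?dim_vline ?v_neq0 //.
  apply/eqP; rewrite -subv0; apply/subvP => y; rewrite memv_cap memv0.
  case/andP=> /oNv yv /vlineP[c yc]; move: yv; rewrite yc bformZl => /eqP.
  by rewrite mulf_eq0 (lt_eqF v0) orbF scaler_eq0 => ->.
apply: pos_dim_max; first exact: subvf.
move=> z /memv_addP[y yN [_ /vlineP[c ->] ->]] nz.
have o := oNv y yN; rewrite opsymE !bformE (bformC B v y) o !mulr0 add0r addr0.
have [y0|y0] := eqVneq y 0.
  rewrite y0 add0r scaler_eq0 negb_or in nz; case/andP: nz => c0 _.
  rewrite y0 bform0l add0r oppr_gt0 mulrA -expr2 pmulr_rlt0 //.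
  by rewrite exprn_even_gt0.
have := dN y yN y0; rewrite opsymE => yy.
have : c * (c * B v v) <= 0 by rewrite mulrA -expr2 mulr_ge0_le0 ?sqr_ge0 // ltW.
lra.
Qed.

(** [v] is completed by a basis of its orthogonal in a maximal positive definite subspace of the
    orthogonal of [w]. The reflection in [v] then negates one member of the frame, and that in [w]
    fixes them all. *)
Lemma frame_exists B p v w : nondegenerate B -> pos_dim B fullv = p ->
  0 < B v v -> B w w < 0 -> B v w = 0 ->
  exists (e : 'I_p -> 'rV[R]_n) (i0 : 'I_p),
  [/\ e i0 = v, forall i, i != i0 -> B (e i) v = 0, forall i, B (e i) w = 0,
      negative_off B e &
      (forall c : 'rV[R]_p, c != 0 -> \sum_i c 0 i *: e i != 0) /\
      (forall c : 'rV[R]_p, 0 <= B (\sum_i c 0 i *: e i) (\sum_i c 0 i *: e i))].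
Proof.
move=> ndB dimp v0 w0 vw.
have v_neq0 : v != 0 by apply/eqP => e; rewrite e bform0l ltxx in v0.
have := pos_dim_orthov_neg ndB w0; rewrite dimp => lep.
have [P0 [P0w dP0 dimP0]] := pos_dim_ex B (orthov B <[w]>).
pose P1 := (P0 :&: orthov B <[v]>)%VS.
(* Orthogonality to [v] costs at most one dimension, so [v] and [P1] together reach dimension
   [p]. *)
have dimP1 : (p <= \dim P1 + 1)%N.
  have := dim_cap_orthov B P0 <[v]>%VS; rewrite dim_vline v_neq0 -/P1; lia.
have oP1v y : y \in P1 -> B y v = 0.
  by rewrite memv_cap => /andP[_ /orthov_eq0]; apply; exact: memv_line.
have oP1w y : y \in P1 -> B y w = 0.
  rewrite memv_cap => /andP[/(subvP P0w)/orthov_eq0 h _]; apply: h.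
  exact: memv_line.
pose s := v :: vbasis P1; pose P := span s.
have PE : P = (<[v]> + P1)%VS.
  by rewrite /P span_cons (span_basis (vbasisP P1)).
have capP : (<[v]> :&: P1 = 0)%VS.
  apply/eqP; rewrite -subv0; apply/subvP => y; rewrite memv_cap memv0.
  case/andP=> /vlineP[c ->] /oP1v; rewrite bformZl => /eqP.
  by rewrite mulf_eq0 (gt_eqF v0) orbF scaler_eq0 => ->.
have dimP : \dim P = (\dim P1).+1.
  by rewrite PE dimv_disjoint_sum // dim_vline v_neq0.
have dP : pos_definite B P.
  rewrite PE => z /memv_addP[_ /vlineP[c ->] [y yP1 ->]] nz.
  rewrite !bformE (bformC B v y) (oP1v y) // !mulr0 addr0 add0r.
  have yP0 : y \in P0 by move: yP1; rewrite memv_cap => /andP[].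
  have cc : 0 <= c * (c * B v v) by rewrite mulrA -expr2 mulr_ge0 ?sqr_ge0 // ltW.
  have [y0|y0] := eqVneq y 0; last by have := dP0 y yP0 y0; lra.
  rewrite y0 addr0 scaler_eq0 negb_or in nz; case/andP: nz => c0 _.
  by rewrite y0 bform0l addr0 mulrA -expr2 mulr_gt0 // exprn_even_gt0.
have dimPp : \dim P = p.
  apply/eqP; rewrite eqn_leq -{1}dimp pos_dim_max ?subvf //=.
  by rewrite dimP -addn1.
have sizes : size s = p by rewrite /= size_tuple -dimP dimPp.
have p0 : (0 < p)%N by rewrite -sizes.
pose e (i : 'I_p) := s`_i.
have sumP (c : 'rV[R]_p) : \sum_i c 0 i *: e i \in P.
  apply: memv_suml => i _; apply: memvZ; apply: memv_span.
  by apply: mem_nth; rewrite sizes.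
have mems i : e i \in s by apply: mem_nth; rewrite sizes.
have free_s : free s.
  by rewrite /free -/P dimPp sizes.
exists e, (Ordinal p0); split=> //.
- move=> [[|i] lti] // _; rewrite /e /=; apply: oP1v; apply: vbasis_mem.
  by apply: mem_nth; rewrite size_tuple -ltnS -dimP dimPp.
- move=> i; have := mems i; rewrite inE => /predU1P[->|] //.
  by move/vbasis_mem/oP1w.
- move=> x x0 xe; apply: (pos_definite_max_orthov ndB dP _ x0).
    by rewrite dimPp.
  rewrite mem_orthov_sym; apply/span_subvP => y ys.
  have lty : (index y s < p)%N by rewrite -sizes index_mem.
  have := xe (Ordinal lty); rewrite /e [nth _ _ _](nth_index 0 ys) => xy.
  by rewrite mem_orthov1 bformC xy.
- split=> c.
    exact: free_nth_sum.
  have [->|nz] := eqVneq (\sum_i c 0 i *: e i) 0; first by rewrite bform0l.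
  by rewrite ltW // dP.
Qed.

End Frames.

(** * The two signs of an isometry *)

Section ComponentClass.
Variables (R : realType) (n : nat).
Implicit Types (B : {symmetric 'rV[R]_n}) (u v w x y : 'rV[R]_n).
Implicit Types (g h k : 'M[R]_n) (b : bool * bool).

(** For orthogonal [v] positive and [w] negative, these represent the four components; [true] stands
    for the sign -1. *)
Definition component_rep B v w b : 'M[R]_n :=
  (if b.1 then reflection B v else 1%:M) *m (if b.2 then reflection B w else 1%:M).

Lemma component_rep_opsym B v w b : B v w = 0 ->
  component_rep (opsym B) w v (b.2, b.1) = component_rep B v w b.
Proof.
move=> vw; rewrite /component_rep /= !reflection_opsym.
by case: b => -[] [] /=; rewrite ?mul1mx ?mulmx1 // (reflection_commute vw).
Qed.

Lemma component_repM B v w b c : B v v != 0 -> B w w != 0 -> B v w = 0 ->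
  component_rep B v w b *m component_rep B v w c =
  component_rep B v w (b.1 (+) c.1, b.2 (+) c.2).
Proof.
move=> v0 w0 vw; have cm := reflection_commute vw.
have vK := reflectionK v0; have wK := reflectionK w0.
have vwv : reflection B v *m reflection B w *m reflection B v = reflection B w.
  by rewrite cm -mulmxA vK mulmx1.
case: b => [[] []]; case: c => [[] []]; rewrite /component_rep /= ?mul1mx ?mulmx1 ?vK ?wK //.
all: try rewrite ?mulmxA ?vwv ?vK ?wK ?mul1mx //.
- by rewrite -mulmxA wK mulmx1.
- by rewrite -cm -mulmxA wK mulmx1.
Qed.

Lemma reflection_same_component_neg B v w : B v v < 0 -> B w w < 0 ->
  same_component B (reflection B v) (reflection B w).
Proof.
move=> v0 w0; rewrite -same_component_opsym.
rewrite -(reflection_opsym B v) -(reflection_opsym B w).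
by apply: reflection_same_component; rewrite opsymE oppr_gt0.
Qed.

(** Each factor of a product of reflections can be joined to the reflection in [v] or in [w],
    according to the sign of its vector. *)
Lemma component_rep_exists B v w g : nondegenerate B -> 0 < B v v ->
  B w w < 0 -> B v w = 0 -> isometry_group B g ->
  exists b, same_component B g (component_rep B v w b).
Proof.
move=> ndB v0 w0 vw; move: g.
have v1 : B v v != 0 by rewrite gt_eqF.
have w1 : B w w != 0 by rewrite lt_eqF.
apply: (isometry_group_ind ndB).
  exists (false, false); rewrite /component_rep /= mul1mx.
  by apply: same_component_refl; exact: iso1.
move=> u g u0 ig [b gb].
have [c uc] : exists c, same_component B (reflection B u) (component_rep B v w c).
  move: u0; rewrite neq_lt => /orP[u0|u0].
    exists (false, true); rewrite /component_rep /= mul1mx.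
    exact: reflection_same_component_neg.
  exists (true, false); rewrite /component_rep /= mulmx1.
  exact: reflection_same_component.
exists (b.1 (+) c.1, b.2 (+) c.2); rewrite -component_repM //.
exact: same_componentM.
Qed.

Lemma component_rep_det B p (m e : 'I_p -> 'rV[R]_n) i0 w b :
  B (e i0) (e i0) != 0 -> (forall i, i != i0 -> B (e i) (e i0) = 0) ->
  (forall i, B (e i) w = 0) ->
  \det (form_mx B m e (component_rep B (e i0) w b)) =
  (-1) ^+ b.1 * \det (form_mx B m e 1%:M).
Proof.
move=> e0 oe ow; rewrite /component_rep; case: b => b1 [] /=.
  rewrite form_mx_reflection_det_id //; case: b1; rewrite ?expr0 ?mul1r //.
  rewrite -[reflection B (e i0)]mul1mx form_mx_reflection_det //.
  by rewrite expr1 mulN1r.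
rewrite mulmx1; case: b1; rewrite ?expr0 ?mul1r //.
rewrite -[reflection B (e i0)]mul1mx form_mx_reflection_det //.
by rewrite expr1 mulN1r.
Qed.

Lemma form_mx_det_same_sign B p (m e : 'I_p -> 'rV[R]_n) g h :
  (forall k, isometry_group B k -> \det (form_mx B m e k) != 0) ->
  same_component B g h ->
  0 < \det (form_mx B m e g) * \det (form_mx B m e h).
Proof.
move=> nz /same_componentP[A [cA Ai Ag Ah]].
by apply: (form_det_same_sign cA) => // x /Ai; exact: nz.
Qed.

Lemma component_rep_inj1 B v w b c : nondegenerate B -> 0 < B v v ->
  B w w < 0 -> B v w = 0 ->
  same_component B (component_rep B v w b) (component_rep B v w c) -> b.1 = c.1.
Proof.
move=> ndB v0 w0 vw bc.
have [e [i0 [ev oe ow neg [fre nonneg]]]] := frame_exists ndB erefl v0 w0 vw.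
have nz k : isometry_group B k -> \det (form_mx B e e k) != 0.
  exact: form_mx_det_neq0.
have e0 : B (e i0) (e i0) != 0 by rewrite ev gt_eqF.
have := form_mx_det_same_sign nz bc.
rewrite -ev in oe *; rewrite !component_rep_det //.
have := nz _ (iso1 B); move: (\det _) => d d0.
have dd : 0 < d * d by rewrite -expr2 exprn_even_gt0.
by case: b.1 c.1 => -[] //; rewrite ?expr0 ?expr1; nra.
Qed.

(** The second bit is the first bit for the opposite form, with [v] and [w] exchanged. *)
Lemma component_rep_inj B v w b c : nondegenerate B -> 0 < B v v ->
  B w w < 0 -> B v w = 0 ->
  same_component B (component_rep B v w b) (component_rep B v w c) -> b = c.
Proof.
move=> ndB v0 w0 vw bc.
have ndB' : nondegenerate (opsym B) by rewrite /nondegenerate orthov_opsym.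
have : b.2 = c.2.
  apply: (@component_rep_inj1 (opsym B) w v (b.2, b.1) (c.2, c.1)) => //.
  - by rewrite opsymE oppr_gt0.
  - by rewrite opsymE oppr_lt0.
  - by rewrite opsymE bformC vw oppr0.
  - by rewrite same_component_opsym !component_rep_opsym.
have := component_rep_inj1 ndB v0 w0 vw bc.
by case: b c {bc} => ? ? [? ?] /= -> ->.
Qed.

(** Stability of the isotropic family gives [form_mx B m e g = A *m form_mx B m e 1%:M], so passing
    from the identity to [g] changes the sign of the determinant by that of [\det A]. It vanishes at
    no isometry, because nonzero isotropic vectors are not sent to negative ones. *)
Lemma component_rep_isotropic B v w b g (m : 'I_(pos_dim B fullv) -> 'rV[R]_n)
    (A : 'M[R]_(pos_dim B fullv)) :
  nondegenerate B -> 0 < B v v -> B w w < 0 -> B v w = 0 ->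
  same_component B g (component_rep B v w b) ->
  isotropic_free B m -> (forall i, m i *m g = \sum_j A i j *: m j) ->
  b.1 = (\det A < 0).
Proof.
move=> ndB v0 w0 vw gb [frm iso0] mg.
have [e [i0 [ev oe ow neg [fre nonneg]]]] := frame_exists ndB erefl v0 w0 vw.
have nz k : isometry_group B k -> \det (form_mx B m e k) != 0.
  apply: form_mx_det_neq0 => // c.
  rewrite bform_suml big1 // => i _; rewrite bformZl bformC bform_suml big1 ?mulr0 //.
  by move=> j _; rewrite bformZl iso0 mulr0.
have e0 : B (e i0) (e i0) != 0 by rewrite ev gt_eqF.
have := form_mx_det_same_sign nz gb.
rewrite -ev in oe *; rewrite component_rep_det //.
have -> : form_mx B m e g = A *m form_mx B m e 1%:M.
  apply/matrixP => i j; rewrite !mxE mg bform_suml; apply: eq_bigr => l _.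
  by rewrite bformZl !mxE mulmx1.
rewrite det_mulmx.
have := nz _ (iso1 B); move: (\det (form_mx _ _ _ _)) => d d0.
have dd : 0 < d * d by rewrite -expr2 exprn_even_gt0.
case: b.1; rewrite ?expr0 ?expr1 => h; apply/esym.
  have : 0 < (- \det A) * (d * d) by nra.
  by rewrite pmulr_lgt0 // oppr_gt0.
have : 0 < \det A * (d * d) by nra.
by rewrite pmulr_lgt0 // => h'; rewrite ltNge ltW.
Qed.

(* c g records the signs by which g acts on the orientations of maximal positive
   and of maximal negative subspaces. *)
Theorem component_class B p q :
    nondegenerate B -> pos_dim B fullv = p -> neg_dim B fullv = q ->
    (0 < p)%N -> (0 < q)%N ->
  exists c : 'M[R]_n -> bool * bool,
  [/\ forall g h, isometry_group B g -> isometry_group B h ->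
        c (g *m h) = ((c g).1 (+) (c h).1, (c g).2 (+) (c h).2),
      forall g, identity_component B g <->
        isometry_group B g /\ c g = (false, false),
      (forall v, 0 < B v v -> c (reflection B v) = (true, false)) /\
      (forall v, B v v < 0 -> c (reflection B v) = (false, true)),
      forall g (m : 'I_p -> 'rV[R]_n) (A : 'M[R]_p), isometry_group B g ->
        isotropic_free B m -> (forall i, m i *m g = \sum_j A i j *: m j) ->
        (c g).1 = (\det A < 0) &
      forall g (m : 'I_q -> 'rV[R]_n) (A : 'M[R]_q), isometry_group B g ->
        isotropic_free B m -> (forall i, m i *m g = \sum_j A i j *: m j) ->
        (c g).2 = (\det A < 0)].
Proof.
move=> ndB <- <- p0 q0.
have [P [N [[_ _ dP dN] [[dimP dimN oNP _] _]]]] := inertia B fullv.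
have [v vP v_neq0] : exists2 v, v \in P & v != 0.
  by exists (vpick P); rewrite ?memv_pick // vpick0 -dimv_eq0 dimP -lt0n.
have [w wN w_neq0] : exists2 w, w \in N & w != 0.
  by exists (vpick N); rewrite ?memv_pick // vpick0 -dimv_eq0 dimN -lt0n.
have v0 := dP v vP v_neq0; have w0 := dN w wN w_neq0.
have vw : B v w = 0 by rewrite bformC (orthov_eq0 (subvP oNP _ wN)).
have v1 : B v v != 0 by rewrite gt_eqF.
have w1 : B w w != 0 by rewrite lt_eqF.
(* The default value is never taken on an isometry, by [component_rep_exists]. *)
pose c g := xget (false, false) [set b | same_component B g (component_rep B v w b)].
have cP g : isometry_group B g -> same_component B g (component_rep B v w (c g)).
  move=> ig; have [b gb] := component_rep_exists ndB v0 w0 vw ig.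
  suff : [set b | same_component B g (component_rep B v w b)] (c g) by [].
  by apply: xgetPex; exists b.
have cE g b : same_component B g (component_rep B v w b) -> c g = b.
  move=> gb; apply: (component_rep_inj ndB v0 w0 vw).
  have gc := cP g (same_component_isol gb).
  exact: same_component_trans (same_component_sym gc) gb.
have rep0 : component_rep B v w (false, false) = 1%:M.
  by rewrite /component_rep mul1mx.
exists c; split.
- move=> g h ig ih; apply: cE; rewrite -component_repM //.
  by apply: same_componentM; exact: cP.
- move=> g; split=> [g1|[ig cg]].
    split; first exact: (same_component_isor g1).
    by apply: cE; rewrite rep0; exact: same_component_sym.
  by apply: same_component_sym; rewrite -rep0 -cg; exact: cP.
- split=> u u0; apply: cE; rewrite /component_rep ?mulmx1 ?mul1mx /=.
    exact: reflection_same_component.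
  exact: reflection_same_component_neg.
- move=> g m A ig im mg.
  exact: (component_rep_isotropic ndB v0 w0 vw (cP g ig) im mg).
(* The same statement for the opposite form, where [v], [w] and the two bits change places. *)
- rewrite -(pos_dim_opsym B fullv) => g m A ig im mg.
  have := @component_rep_isotropic (opsym B) w v ((c g).2, (c g).1) g m A.
  rewrite /= component_rep_opsym // same_component_opsym; apply.
  + by rewrite /nondegenerate orthov_opsym.
  + by rewrite opsymE oppr_gt0.
  + by rewrite opsymE oppr_lt0.
  + by rewrite opsymE bformC vw oppr0.
  + exact: cP.
  + by case: im => fm im; split=> // i j; rewrite opsymE im oppr0.
  + exact: mg.
Qed.

End ComponentClass.

(** * Orbits and component classes *)

Section Orbits.
Variables (R : realType) (n : nat) (B : {symmetric 'rV[R]_n}).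
Implicit Types (u v w x y : 'rV[R]_n) (g h k t : 'M[R]_n).
Implicit Types (S X U W : {vspace 'rV[R]_n}).

Lemma mem_gact g S y : reflect (exists2 x, x \in S & y = x *m g) (y \in gact g S).
Proof.
apply: (iffP memv_imgP) => -[x xS ->]; exists x => //; by rewrite lfunE.
Qed.

Lemma memv_gact g S x : x \in S -> x *m g \in gact g S.
Proof. by move=> xS; apply/mem_gact; exists x. Qed.

Lemma gact1 S : gact 1%:M S = S.
Proof.
apply/vspaceP => y; apply/mem_gact/idP => [[x xS ->]|yS]; first by rewrite mulmx1.
by exists y; rewrite ?mulmx1.
Qed.

Lemma gactM g h S : gact (g *m h) S = gact h (gact g S).
Proof.
apply/vspaceP => y; apply/mem_gact/mem_gact => [[x xS ->]|[_ /mem_gact[x xS ->] ->]].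
  by exists (x *m g); rewrite ?mulmxA ?memv_gact.
by exists x; rewrite ?mulmxA.
Qed.

Lemma gact_invmx g S X : g \in unitmx -> gact g S = X -> gact (invmx g) X = S.
Proof. by move=> ug <-; rewrite -gactM mulmxV // gact1. Qed.

Lemma gact_involution g S : (forall x, x \in S -> x *m g \in S) ->
  g *m g = 1%:M -> gact g S = S.
Proof.
move=> gS gg; apply/vspaceP => y; apply/mem_gact/idP => [[x xS ->]|yS]; first exact: gS.
by exists (y *m g); rewrite ?gS // -mulmxA gg mulmx1.
Qed.

Section Product.
Variables (U W : {vspace 'rV[R]_n}).
Hypotheses (UWV : (U + W)%VS = fullv) (UoW : (U <= orthov B W)%VS).
Notation H := (isometry_prod B U W).

Lemma memv_add_split x : exists a b, [/\ a \in U, b \in W & x = a + b].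
Proof.
have : x \in (U + W)%VS by rewrite UWV memvf.
by case/memv_addP=> a aU [b bW ->]; exists a, b.
Qed.

Lemma form_split u w : u \in U -> w \in W -> B u w = 0.
Proof. by move=> /(subvP UoW) /orthov_eq0; apply. Qed.

Lemma prod_memU g x : H g -> x \in U -> x *m g \in U.
Proof. by case=> _ gU _ _ _ xU; rewrite -gU memv_gact. Qed.

Lemma prod_memW g x : H g -> x \in W -> x *m g \in W.
Proof. by case=> _ _ gW _ _ xW; rewrite -gW memv_gact. Qed.

Lemma prod_iso g : H g -> isometry_group B g.
Proof.
move=> Hg; have [ug _ _ gU gW] := Hg; split=> //= x y.
have [a [b [aU bW ->]]] := memv_add_split x.
have [a' [b' [aU' bW' ->]]] := memv_add_split y.
rewrite /= !mulmxDl !bformDl !bformDr (gU a a') // (gW b b') //.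
rewrite (form_split (prod_memU Hg aU)) ?prod_memW //.
rewrite (bformC B (b *m g)) (form_split (prod_memU Hg aU')) ?prod_memW //.
by rewrite (form_split aU bW') (bformC B b a') (form_split aU' bW).
Qed.

Lemma iso_prod g : isometry_group B g -> gact g U = U -> gact g W = W -> H g.
Proof.
by move=> ig gU gW; split=> //; [exact: iso_unit ig|move=> x y _ _; exact: isoB..].
Qed.

Lemma prod_U g : H g -> gact g U = U. Proof. by case. Qed.
Lemma prod_W g : H g -> gact g W = W. Proof. by case. Qed.

Lemma prod1 : H 1%:M.
Proof. by apply: iso_prod; rewrite ?gact1 //; exact: iso1. Qed.

Lemma prodM g h : H g -> H h -> H (g *m h).
Proof.
move=> Hg Hh; apply: iso_prod; first by apply: isoM; exact: prod_iso.
  by rewrite gactM !prod_U.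
by rewrite gactM !prod_W.
Qed.

Lemma prodV g : H g -> H (invmx g).
Proof.
move=> Hg; have ug : g \in unitmx by case: Hg.
apply: iso_prod; first by apply: isoV; exact: prod_iso.
  by apply: gact_invmx => //; exact: prod_U.
by apply: gact_invmx => //; exact: prod_W.
Qed.

Lemma reflection_prod v : B v v != 0 -> v \in U \/ v \in W -> H (reflection B v).
Proof.
move=> v0 vUW; have vv := reflectionK v0.
have stab X : v \in X \/ X = U /\ v \in W \/ X = W /\ v \in U ->
    gact (reflection B v) X = X.
  move=> h; apply: gact_involution => // x xX; rewrite mulmx_reflection.
  case: h => [vX|h]; first by rewrite memvB // memvZ.
  have -> : B x v = 0; last by rewrite mulr0 mul0r scale0r subr0.
  case: h xX => -[-> vX] xX; first exact: form_split.
  by rewrite bformC form_split.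
by apply: iso_prod; [exact: reflection_iso | apply: stab; intuition..].
Qed.

Variable c : 'M[R]_n -> bool * bool.
Hypothesis cM : forall g h, isometry_group B g -> isometry_group B h ->
  c (g *m h) = ((c g).1 (+) (c h).1, (c g).2 (+) (c h).2).
Hypothesis c0 : forall g, identity_component B g <->
  isometry_group B g /\ c g = (false, false).

Notation H0 := (H `&` identity_component B).

Lemma classV g : isometry_group B g -> c (invmx g) = c g.
Proof.
move=> ig; have := cM ig (isoV ig); rewrite mulmxV ?(iso_unit ig) //.
have /c0[_ ->] : identity_component B 1%:M.
  by apply: connected_component_refl; exact: iso1.
by case: (c g) => [[] []]; case: (c _) => [[] []].
Qed.

(** These [b] form the image in the group of classes of the stabilizer of [S] in [H]. *)
Definition stab_class S (b : bool * bool) :=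
  exists t, [/\ H t, gact t S = S & c t = b].

(** [H0] is the kernel of [c] on [H], and matrices act on the right. If [k] in [H0] carries
    [gact g S] to [gact h S], then [g *m k *m invmx h] stabilizes [S], and its class is the sum of
    those of [g] and [h]. *)
Lemma orbit_eqP S g h : H g -> H h ->
  orbit_of H0 (gact g S) = orbit_of H0 (gact h S) <->
  stab_class S ((c g).1 (+) (c h).1, (c g).2 (+) (c h).2).
Proof.
have sub g' h' : H g' -> H h' ->
    stab_class S ((c g').1 (+) (c h').1, (c g').2 (+) (c h').2) ->
    orbit_of H0 (gact g' S) `<=` orbit_of H0 (gact h' S).
  move=> Hg Hh [t [Ht tS ct]] _ [k [Hk k0] <-].
  (* [invmx h'] leads back to [S], which [t] preserves. The factor [t] has the class that makes the
     total class trivial. *)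
  exists (invmx h' *m (t *m (g' *m k))); last first.
    have uh : h' \in unitmx by case: Hh.
    by rewrite -!gactM mulKVmx // [LHS]gactM tS.
  have Hgk : H (t *m (g' *m k)) by do !apply: prodM.
  split; first by apply: prodM => //; exact: prodV.
  apply/c0; split; first by apply: prod_iso; apply: prodM => //; exact: prodV.
  have ih := prod_iso Hh; have [_ ck] := (c0 k).1 k0.
  have [ig it] := (prod_iso Hg, prod_iso Ht); have ik := prod_iso Hk.
  rewrite (cM (isoV ih) (prod_iso Hgk)) (classV ih) (cM it (isoM ig ik)).
  rewrite (cM ig ik) ct ck /=.
  by case: (c g') => [[] []]; case: (c h') => [[] []].
move=> Hg Hh; split=> [e|st]; last first.
  apply/seteqP; split; apply: sub => //.
  by rewrite (addbC (c h).1) (addbC (c h).2).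
have : orbit_of H0 (gact h S) (gact h S).
  exists 1%:M; last by rewrite gact1.
  by split; [exact: prod1 | apply: connected_component_refl; exact: iso1].
rewrite -e => -[k [Hk k0] ek].
have [ig ih] := (prod_iso Hg, prod_iso Hh); have [ik ck] := (c0 k).1 k0.
exists (g *m k *m invmx h); split.
- by apply: prodM; [exact: prodM | exact: prodV].
- rewrite gactM gactM ek; apply: gact_invmx => //; exact: iso_unit ih.
- by rewrite (cM (isoM ig ik) (isoV ih)) (classV ih) (cM ig ik) ck /= !addbF.
Qed.

(* l separates the cosets of the group of classes of the stabilizer of S. *)
Lemma orbits_in_card S (m : nat) (l : bool * bool -> nat) :
  (forall b, exists2 g, H g & c g = b) ->
  (forall b b', l b = l b' <-> stab_class S (b.1 (+) b'.1, b.2 (+) b'.2)) ->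
  (forall b, (l b < m)%N) -> (forall i, (i < m)%N -> exists b, l b = i) ->
  orbits_in H0 (orbit_of H S) #= `I_m.
Proof.
move=> csurj lE lm lsurj; apply/card_set_bijP.
pose rep (X : set {vspace 'rV[R]_n}) g := H g /\ X = orbit_of H0 (gact g S).
(* An orbit is labelled by the class of a chosen representative; the default 0 is never taken on an
   actual orbit. *)
pose f (X : set {vspace 'rV[R]_n}) := l (c (xget 0 [set g | rep X g])).
have repP (X : set {vspace 'rV[R]_n}) : orbits_in H0 (orbit_of H S) X -> rep X (xget 0 [set g | rep X g]).
  move=> [_ [g Hg <-] <-].
  suff : [set g' | rep (orbit_of H0 (gact g S)) g']
    (xget 0 [set g' | rep (orbit_of H0 (gact g S)) g']) by [].
  by apply: xgetPex; exists g.
exists f; split.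
- by move=> X _; exact: lm.
- move=> X Y; rewrite !inE => /repP[Hx eX] /repP[Hy eY] /lE st.
  by rewrite eX eY; apply/orbit_eqP.
- move=> i /= /lsurj[b <-]; have [g Hg <-] := csurj b.
  have oX : orbits_in H0 (orbit_of H S) (orbit_of H0 (gact g S)).
    by exists (gact g S) => //; exists g.
  exists (orbit_of H0 (gact g S)) => //.
  have [Hx /esym eX] := repP _ oX.
  by apply/lE; apply/orbit_eqP.
Qed.


End Product.
End Orbits.

(** * Projections and stabilizers of isotropic subspaces *)

Section Projection.
Variables (R : realType) (n : nat).
Implicit Types (B : {symmetric 'rV[R]_n}) (u v w x y z : 'rV[R]_n) (g : 'M[R]_n).
Implicit Types (S X Y P N U W : {vspace 'rV[R]_n}).

Lemma dim_nondegenerate B U : (U :&: orthov B U = 0)%VS ->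
  \dim U = (pos_dim B U + neg_dim B U)%N.
Proof.
by move=> ndU; have [_ [_ [_ [_ ->]]]] := inertia B U; rewrite /Rad ndU dimv0 addn0.
Qed.

(** A maximal positive definite subspace of [X] plus the radical is positive semidefinite, so it
    meets a maximal negative definite subspace of [U] trivially. *)
Lemma pos_dim_rad_le B U X : (U :&: orthov B U = 0)%VS -> (X <= U)%VS ->
  (pos_dim B X + \dim (Rad B X) <= pos_dim B U)%N.
Proof.
move=> ndU XU; have [P [_ [[PX _ dP _] [[dimP _ _ _] _]]]] := inertia B X.
have [_ [N [[_ NU _ dN] [[_ dimN _ _] _]]]] := inertia B U.
have RX : (Rad B X <= X)%VS by apply: capvSl.
have rad0 x y : x \in Rad B X -> y \in X -> B x y = 0.
  by rewrite memv_cap => /andP[_ /orthov_eq0]; apply.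
have : (\dim N + \dim (P + Rad B X) <= \dim U)%N.
  apply: (dim_definite_add (B := opsym B)) => //.
  - by rewrite (subv_trans _ XU) // subv_add PX.
  - by rewrite pos_definite_opsym.
  move=> v /memv_addP[x xP [y yR ->]]; rewrite opsymE oppr_le0 !bformE.
  rewrite (bformC B x y) (rad0 y x) ?(subvP PX) // (rad0 y y) ?(subvP RX) // !addr0.
  by have [->|x0] := eqVneq x 0; rewrite ?bform0l // ltW // dP.
rewrite (dim_nondegenerate ndU) dimv_disjoint_sum ?dimP ?dimN; first by lia.
apply: (definite_cap0 dP) => y yR.
by rewrite (rad0 y y) ?(subvP RX).
Qed.

(** Otherwise the orthogonal of [X] in [U], plus a maximal negative definite subspace of [X], is
    negative semidefinite; its dimension is too large beside a maximal positive definite subspace of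
    [U]. *)
Lemma exists_pos_orthov B U X : (U :&: orthov B U = 0)%VS -> (X <= U)%VS ->
  (pos_dim B X + \dim (Rad B X) < pos_dim B U)%N ->
  exists v, [/\ v \in U, v \in orthov B X & 0 < B v v].
Proof.
move=> ndU XU lt; apply: contrapT => no.
have nonpos v : v \in U -> v \in orthov B X -> B v v <= 0.
  by move=> vU vX; rewrite leNgt; apply/negP => v0; apply: no; exists v.
have [_ [N [[_ NX _ dN] [[_ dimN _ _] dimX]]]] := inertia B X.
have [P [_ [[PU _ dP _] [[dimP _ _ _] _]]]] := inertia B U.
pose Y := (U :&: orthov B X + N)%VS.
have : (\dim P + \dim Y <= \dim U)%N.
  apply: (dim_definite_add PU _ dP).
    by rewrite subv_add capvSl (subv_trans NX XU).
  move=> v /memv_addP[x]; rewrite memv_cap => /andP[xU xX] [y yN ->].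
  rewrite !bformE (bformC B y x) (orthov_eq0 xX (subvP NX _ yN)) addr0 add0r.
  have [->|y0] := eqVneq y 0; first by rewrite bform0l addr0 nonpos.
  by have := dN y yN y0; have := nonpos x xU xX; lra.
have capN : (U :&: orthov B X :&: N = 0)%VS.
  apply/eqP; rewrite -subv0; apply/subvP => v; rewrite !memv_cap memv0.
  case/andP=> /andP[_ vX] vN; apply/negPn/negP => v0.
  by have := dN v vN v0; rewrite (orthov_eq0 vX (subvP NX _ vN)) ltxx.
rewrite dimv_disjoint_sum // (dim_nondegenerate ndU).
have := dim_cap_orthov B U X; rewrite (dim_nondegenerate ndU).
lia.
Qed.

Lemma mem_sproj U W S x :
  reflect (x \in U /\ exists2 w, w \in W & x + w \in S) (x \in sproj U W S).
Proof.
rewrite memv_cap; apply: (iffP andP) => [[/memv_addP[s sS [w wW ->]] xU]|].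
  by split=> //; exists (- w); rewrite ?memvN // addrK.
case=> xU [w wW xwS]; split=> //; rewrite -(addrK w x).
by rewrite memv_add ?memvN.
Qed.

Lemma sproj_sub U W S : (sproj U W S <= U)%VS. Proof. exact: capvSr. Qed.

Lemma form_split_isotropic B U W S u w :
  (U <= orthov B W)%VS -> (S <= orthov B S)%VS ->
  u \in U -> w \in W -> u + w \in S -> B w w = - B u u.
Proof.
move=> UoW SS uU wW uwS; have := orthov_eq0 (subvP SS _ uwS) uwS.
by rewrite !bformE (bformC B w u) (form_split UoW uU wW); lra.
Qed.

Lemma split_unique U W u u' w w' : (U :&: W = 0)%VS ->
  u \in U -> u' \in U -> w \in W -> w' \in W ->
  u + w = u' + w' -> u = u' /\ w = w'.
Proof.
move=> UIW uU uU' wW wW' e; have d : u - u' = w' - w.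
  by apply/rowP => i; move/rowP/(_ i): e; rewrite !mxE; lra.
have : u - u' \in (U :&: W)%VS by rewrite memv_cap memvB // d memvB.
rewrite UIW memv0 => h; move: (h); rewrite d !subr_eq0 => /eqP ->.
by move: h; rewrite subr_eq0 => /eqP ->.
Qed.

(** Rank and nullity of the projection along [W], counted through [S + W = sproj U W S + W]. *)
Lemma dim_sproj U W S : (U + W = fullv)%VS -> (U :&: W = 0)%VS ->
  (\dim (sproj U W S) + \dim (S :&: W))%N = \dim S.
Proof.
move=> UWV UIW; have sum : (S + W = sproj U W S + W)%VS.
  apply/eqP; rewrite eqEsubv !subv_add !addvSr !andbT; apply/andP; split.
    apply/subvP => s sS; have [u [w [uU wW e]]] := memv_add_split UWV s.
    rewrite e memv_add //; apply/mem_sproj; split=> //; exists w => //.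
    by rewrite -e.
  exact: capvSl.
have capW : (sproj U W S :&: W = 0)%VS.
  by apply/eqP; rewrite -subv0 -UIW; apply: capvS => //; exact: sproj_sub.
have := dimv_sum_cap S W; rewrite sum dimv_disjoint_sum //; lia.
Qed.

(** A vector of [S :&: U] pairs with the [U]-component of an element of [S] as it does with the
    element itself, namely to 0. *)
Lemma cap_sub_Rad_sproj B U W S : (U <= orthov B W)%VS -> (S <= orthov B S)%VS ->
  (S :&: U <= Rad B (sproj U W S))%VS.
Proof.
move=> UoW SS; apply/subvP => x; rewrite memv_cap => /andP[xS xU].
rewrite memv_cap; apply/andP; split.
  by apply/mem_sproj; split=> //; exists 0; rewrite ?mem0v ?addr0.
apply/mem_orthovP => u /mem_sproj[uU [w wW uwS]].
have := orthov_eq0 (subvP SS _ xS) uwS.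
by rewrite bformDr (form_split UoW xU wW) addr0.
Qed.

(* The part of S over a negative definite N in U has equal dimension modulo
   S :&: W, and B on its W-components is opposite to B on N. *)
Lemma neg_dim_sproj_le B U W S : (U + W = fullv)%VS -> (U :&: W = 0)%VS ->
  (U <= orthov B W)%VS -> (S <= orthov B S)%VS ->
  (neg_dim B (sproj U W S) <= pos_dim B (sproj W U S))%N.
Proof.
move=> UWV UIW UoW SS.
have [_ [N [[_ NP _ dN] [[_ <- _ _] _]]]] := inertia B (sproj U W S).
have NU := subv_trans NP (sproj_sub U W S).
pose S' := (S :&: (N + W))%VS; pose Q := sproj W U S'.
have dimQ := dim_sproj S' (etrans (addvC _ _) UWV) (etrans (capvC _ _) UIW).
have dimN := dim_sproj S' UWV UIW.
have NS' : (N <= sproj U W S')%VS.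
  apply/subvP => x xN; have /mem_sproj[xU [w wW xwS]] := subvP NP _ xN.
  by apply/mem_sproj; split=> //; exists w; rewrite // memv_cap xwS memv_add.
have inN x u : x \in W -> u \in U -> x + u \in S' -> u \in N.
  rewrite memv_cap => xW uU /andP[_ /memv_addP[y yN [w wW]]]; rewrite addrC => e.
  by have [-> _] := split_unique UIW uU (subvP NU _ yN) xW wW e.
have S'W : (S' :&: W = S :&: W)%VS.
  apply/vspaceP => x; rewrite !memv_cap; case: (boolP (x \in W)); rewrite ?andbF //.
  by move=> xW; rewrite (subvP (addvSr N W)) // andbT.
have S'U : (S' :&: U = 0)%VS.
  apply/eqP; rewrite -subv0; apply/subvP => x; rewrite memv_cap memv0.
  case/andP=> xS' xU; apply/negPn/negP => x0.
  have xN : x \in N by apply: (@inN 0); rewrite ?mem0v ?add0r.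
  move: xS'; rewrite memv_cap => /andP[xS _].
  by have := dN x xN x0; rewrite (orthov_eq0 (subvP SS _ xS) xS) ltxx.
(* A nonzero vector of this complement is the [W]-component of an element of [S] whose [U]-component
   is nonzero and in [N]. *)
pose Q' := (Q :\: (S :&: W))%VS.
have dimQ' : (\dim N <= \dim Q')%N.
  have := dimv_cap_compl Q (S :&: W); have := dimvS NS'.
  have := dimvS (capvSr Q (S :&: W)).
  move: dimQ dimN; rewrite -/Q -/Q' S'W S'U dimv0; lia.
apply: (leq_trans dimQ'); apply: pos_dim_max.
  apply: (subv_trans (diffvSl _ _)); apply: capvS => //.
  by apply: addvS => //; exact: capvSl.
move=> x xQ' x0; have xQ := subvP (diffvSl _ _) _ xQ'.
have /mem_sproj[xW [u uU xuS']] := xQ.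
have uN := inN x u xW uU xuS'; have xuS := subvP (capvSl _ _) _ xuS'.
have u0 : u != 0.
  apply: contraNneq x0 => u0; rewrite -memv0 -(capv_diff Q (S :&: W)).
  by rewrite !memv_cap xQ' xW -[x]addr0 -u0 xuS.
by rewrite addrC in xuS; rewrite (form_split_isotropic UoW SS uU xW xuS)
  oppr_gt0 dN.
Qed.

(** The reverse inequality is the previous one for the opposite form, with [U] and [W] exchanged. *)
Lemma neg_dim_sproj B U W S : (U + W = fullv)%VS -> (U :&: W = 0)%VS ->
  (U <= orthov B W)%VS -> (S <= orthov B S)%VS ->
  neg_dim B (sproj U W S) = pos_dim B (sproj W U S).
Proof.
move=> UWV UIW UoW SS; apply/eqP; rewrite eqn_leq neg_dim_sproj_le //=.
rewrite -(neg_dim_opsym B) -(pos_dim_opsym B) neg_dim_sproj_le ?orthov_opsym //.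
- by rewrite addvC.
- by rewrite capvC.
- by rewrite orthov_sym.
Qed.

End Projection.

(** * Elements that stabilize an isotropic subspace, and their action *)

Section Stabilizers.
Variables (R : realType) (n : nat).
Implicit Types (B : {symmetric 'rV[R]_n}) (u v w x y z : 'rV[R]_n) (g : 'M[R]_n).
Implicit Types (S X Y U W : {vspace 'rV[R]_n}).

(** [v] is orthogonal to both components of every vector of [S], so the reflection fixes [S]
    pointwise. *)
Lemma reflection_stab B U W S v : (U + W = fullv)%VS -> (U <= orthov B W)%VS ->
  v \in U -> v \in orthov B (sproj U W S) -> B v v != 0 ->
  gact (reflection B v) S = S.
Proof.
move=> UWV UoW vU vX v0; apply: gact_involution; last exact: reflectionK.
move=> s sS; rewrite reflection_fix //.
have [u [w [uU wW e]]] := memv_add_split UWV s.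
have uX : u \in sproj U W S by apply/mem_sproj; split=> //; exists w; rewrite // -e.
by rewrite e bformDl bformC (orthov_eq0 vX uX) bformC (form_split UoW vU wW) addr0.
Qed.

(** Isotropy of [S] gives [B s y = - B s x] on [S], so both reflections together move [s] by a
    multiple of [x + y]. *)
Lemma reflection_pair_stab B S x y : (S <= orthov B S)%VS -> B x y = 0 ->
  B y y = - B x x -> B x x != 0 -> x + y \in S ->
  gact (reflection B x *m reflection B y) S = S.
Proof.
move=> SS xy yx x0 xyS; have y0 : B y y != 0 by rewrite yx oppr_eq0.
apply: gact_involution => [s sS|]; last first.
  rewrite {1}(reflection_commute xy) -mulmxA (mulmxA (reflection B x)).
  by rewrite reflectionK // mul1mx reflectionK.
have sxy : B s y = - B s x.
  by have := orthov_eq0 (subvP SS _ sS) xyS; rewrite bformDr; lra.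
suff -> : s *m (reflection B x *m reflection B y) =
    s - (2 * B s x / B x x) *: (x + y) by rewrite memvB // memvZ.
rewrite mulmxA !mulmx_reflection !bformE xy sxy yx.
by apply/rowP => i; rewrite !mxE; field.
Qed.

(* An isotropic vector x is split off a hyperbolic plane as
   (x/2 + y) + (x/2 - y) with y isotropic. *)
Lemma isotropic_split B U x : (U :&: orthov B U = 0)%VS -> x \in U -> x != 0 ->
  B x x = 0 ->
  exists u w, [/\ u \in U /\ w \in U, B u w = 0, B w w = - B u u, B u u != 0 &
    u + w = x].
Proof.
move=> ndU xU x0 xx.
have [z zU xz] : exists2 z, z \in U & B x z != 0.
  apply/mem_orthovPn; apply: contra x0 => xo.
  by rewrite -memv0 -ndU memv_cap xU.
(* This multiple of [x] makes [y] isotropic and leaves [B x y] equal to [B x z]. *)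
pose y := z - (B z z / (2 * B x z)) *: x.
have yU : y \in U by rewrite memvB // memvZ.
have xy : B x y = B x z by rewrite /y !bformE xx mulr0 subr0.
have yy : B y y = 0.
  rewrite /y !bformE xx (bformC B z x); field; exact: xz.
clearbody y; exists (2^-1 *: x + y), (2^-1 *: x - y); split.
- by rewrite memvD ?memvB ?memvZ.
- by rewrite !bformE (bformC B y x) xx yy xy; lra.
- by rewrite !bformE (bformC B y x) xx yy xy; lra.
- rewrite !bformE (bformC B y x) xx yy xy.
  suff -> : 2^-1 * (2^-1 * 0) + 2^-1 * B x z + (2^-1 * B x z + 0) = B x z by [].
  by lra.
- by apply/rowP => i; rewrite !mxE; lra.
Qed.

(** A positive signature provides an anisotropic [u] in the projection; the [W]-component of a lift
    to [S] has the opposite norm. *)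
Lemma pair_in_sproj B U W S : (U <= orthov B W)%VS -> (S <= orthov B S)%VS ->
  (0 < pos_dim B (sproj U W S) + neg_dim B (sproj U W S))%N ->
  exists u w, [/\ u \in U /\ w \in W, B u w = 0, B w w = - B u u, B u u != 0 &
    u + w \in S].
Proof.
move=> UoW SS pos.
suff [u uX u0] : exists2 u, u \in sproj U W S & B u u != 0.
  have /mem_sproj[uU [w wW uwS]] := uX; exists u, w; split=> //.
    exact: (form_split UoW uU wW).
  exact: (form_split_isotropic UoW SS uU wW uwS).
have [P [N [[PX NX dP dN] [[dimP dimN _ _] _]]]] := inertia B (sproj U W S).
have [P0|P0] := eqVneq P 0%VS.
  have N0 : N != 0%VS by rewrite -dimv_eq0 dimN; move: pos; rewrite -dimP P0 dimv0; lia.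
  exists (vpick N); first by rewrite (subvP NX) ?memv_pick.
  by rewrite lt_eqF // dN ?memv_pick // vpick0.
exists (vpick P); first by rewrite (subvP PX) ?memv_pick.
by rewrite gt_eqF // dP ?memv_pick // vpick0.
Qed.

Lemma isotropic_basis B X : (X <= orthov B X)%VS ->
  isotropic_free B (fun i : 'I_(\dim X) => (vbasis X)`_i).
Proof.
move=> XX; have mem (i : 'I_(\dim X)) : (vbasis X)`_i \in X.
  by apply: vbasis_mem; rewrite mem_nth ?size_tuple.
split=> [c c0|i j]; last exact: (orthov_eq0 (subvP XX _ (mem i)) (mem j)).
by apply: free_nth_sum => //; [exact: (basis_free (vbasisP X))|rewrite size_tuple].
Qed.

Lemma gact_basis X g : gact g X = X -> forall i : 'I_(\dim X),
  (vbasis X)`_i *m g =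
  \sum_j (\matrix_(i, j) coord (vbasis X) j ((vbasis X)`_i *m g)) i j *: (vbasis X)`_j.
Proof.
move=> gX i.
have iX : (vbasis X)`_i \in X by rewrite vbasis_mem // mem_nth // size_tuple.
have := memv_gact g iX; rewrite gX => /coord_vbasis e; rewrite [LHS]e.
by apply: eq_bigr => j _; rewrite mxE.
Qed.

Lemma gact_sproj B U W S g : isometry_prod B U W g -> gact g S = S ->
  gact g (sproj U W S) = sproj U W S.
Proof.
move=> Hg gS; have [ug gU gW _ _] := Hg.
have sub (h : 'M[R]_n) : gact h U = U -> gact h W = W -> gact h S = S ->
    forall x, x \in sproj U W S -> x *m h \in sproj U W S.
  move=> hU hW hS x /mem_sproj[xU [w wW xwS]]; apply/mem_sproj; split.
    by rewrite -hU memv_gact.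
  exists (w *m h); first by rewrite -hW memv_gact.
  by rewrite -mulmxDl -hS memv_gact.
apply/vspaceP => y; apply/mem_gact/idP => [[x xX ->]|yX]; first exact: (sub g).
exists (y *m invmx g); last by rewrite mulmxKV.
by apply: sub => //; apply: gact_invmx.
Qed.

Lemma gact_Rad B X g : isometry_group B g -> gact g X = X ->
  gact g (Rad B X) = Rad B X.
Proof.
move=> ig gX.
have sub (h : 'M[R]_n) : isometry_group B h -> gact h X = X ->
    forall x, x \in Rad B X -> x *m h \in Rad B X.
  move=> ih hX x; rewrite !memv_cap => /andP[xX xo].
  rewrite -{1}hX memv_gact //=; apply/mem_orthovP => y.
  by rewrite -{1}hX => /mem_gact[z zX ->]; rewrite isoB // (orthov_eq0 xo).
have ug := iso_unit ig.
apply/vspaceP => y; apply/mem_gact/idP => [[x xX ->]|yX]; first exact: (sub g).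
exists (y *m invmx g); last by rewrite mulmxKV.
by apply: sub => //; [exact: isoV | apply: gact_invmx].
Qed.

Lemma gact_add X Y g : gact g (X + Y) = (gact g X + gact g Y)%VS.
Proof. exact: limgD. Qed.

(** Pairing a vector of the radical with [s] in [S] only sees the [U]-component of [s], which lies
    in the projection. *)
Lemma add_Rad_isotropic B U W S : (U + W = fullv)%VS -> (U <= orthov B W)%VS ->
  (S <= orthov B S)%VS ->
  (S + Rad B (sproj U W S) <= orthov B (S + Rad B (sproj U W S)))%VS.
Proof.
move=> UWV UoW SS; set Z := Rad _ _.
have ZZ : (Z <= orthov B Z)%VS.
  apply/orthovP => x y xZ yZ; move: xZ; rewrite memv_cap => /andP[_ xo].
  by rewrite (orthov_eq0 xo) // (subvP (capvSl _ _) _ yZ).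
have SZ : (S <= orthov B Z)%VS.
  apply/orthovP => s x sS; rewrite memv_cap => /andP[xX xo].
  have [u [w [uU wW e]]] := memv_add_split UWV s.
  have uX : u \in sproj U W S.
    by apply/mem_sproj; split=> //; exists w; rewrite // -e.
  have xU := subvP (sproj_sub U W S) _ xX.
  rewrite e bformDl bformC (orthov_eq0 xo uX) bformC.
  by rewrite (form_split UoW xU wW) addr0.
by rewrite orthoDv !orthovD SS SZ ZZ orthov_sym SZ.
Qed.

(** [S] meets the radical exactly in [S :&: U]. *)
Lemma dim_add_Rad B U W S : (U <= orthov B W)%VS -> (S <= orthov B S)%VS ->
  (\dim (S + Rad B (sproj U W S)) + \dim (S :&: U) =
   \dim S + \dim (Rad B (sproj U W S)))%N.
Proof.
move=> UoW SS; rewrite -(dimv_sum_cap S); congr (_ + \dim _)%N.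
apply/eqP; rewrite eqEsubv; apply/andP; split.
  by rewrite subv_cap capvSl cap_sub_Rad_sproj.
by apply: capvS => //; apply: subv_trans (sproj_sub U W S); exact: capvSl.
Qed.

(* Both projections of S are isomorphic to S, and a stabilizing element of the
   product acts on them by the same matrix. *)
Lemma isotropic_double B U W S : (U + W = fullv)%VS -> (U :&: W = 0)%VS ->
  (U <= orthov B W)%VS -> (S <= orthov B S)%VS ->
  (S :&: U = 0)%VS -> (S :&: W = 0)%VS ->
  (sproj U W S <= orthov B (sproj U W S))%VS ->
  exists m : 'I_(\dim S + \dim S) -> 'rV[R]_n, isotropic_free B m /\
    forall g, isometry_prod B U W g -> gact g S = S ->
    exists2 A : 'M[R]_(\dim S + \dim S),
      forall i, m i *m g = \sum_j A i j *: m j & 0 <= \det A.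
Proof.
move=> UWV UIW UoW SS SU SW PP.
pose s (i : 'I_(\dim S)) := (vbasis S)`_i.
have sS i : s i \in S by apply: vbasis_mem; rewrite mem_nth ?size_tuple.
have /choice[u uP] : forall i, exists u, u \in U /\ s i - u \in W.
  move=> i; have [a [b [aU bW e]]] := memv_add_split UWV (s i).
  by exists a; split=> //; rewrite e addrC addKr.
have uU i : u i \in U by case: (uP i).
have wW i : s i - u i \in W by case: (uP i).
pose m (i : 'I_(\dim S + \dim S)) :=
  match fintype.split i with inl j => u j | inr j => s j - u j end.
have ml i : m (lshift _ i) = u i by rewrite /m (unsplitK (inl i)).
have mr i : m (rshift _ i) = s i - u i by rewrite /m (unsplitK (inr i)).
have uX i : u i \in sproj U W S.
  by apply/mem_sproj; split=> //; exists (s i - u i); rewrite // addrC subrK.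
have uu i j : B (u i) (u j) = 0 by rewrite (orthov_eq0 (subvP PP _ (uX i))).
have uw i j : B (u i) (s j - u j) = 0 by exact: (form_split UoW (uU i) (wW j)).
have ss i j : B (s i) (s j) = 0 by rewrite (orthov_eq0 (subvP SS _ (sS i))).
have ww i j : B (s i - u i) (s j - u j) = 0.
  have := uw j i; have := uw i j; rewrite !bformE !uu !ss (bformC B (s i) (u j)).
  by lra.
have [sfree _] := isotropic_basis SS.
exists m; split; first split.
- move=> c; apply: contraNneq; rewrite big_split_ord /=.
  under eq_bigr do rewrite ml; under [X in _ + X]eq_bigr do rewrite mr.
  move=> e.
  have e1 : \sum_i c 0 (lshift _ i) *: u i = 0 /\
      \sum_i c 0 (rshift _ i) *: (s i - u i) = 0.
    apply: (split_unique UIW); rewrite ?mem0v ?addr0 //.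
      by apply: memv_suml => i _; exact: memvZ.
    by apply: memv_suml => i _; exact: memvZ.
  have zero (d : 'rV[R]_(\dim S)) : \sum_i d 0 i *: s i = 0 -> d = 0.
    by move=> d0; apply: contra_eq d0 => /sfree.
  (* If the [U]-components of a combination of the [s i] cancel, the combination lies in [S :&: W],
     which is zero; [cr] is symmetric. *)
  have cl : lsubmx c = 0.
    apply: zero; apply/eqP; rewrite -memv0 -SW memv_cap memv_suml /=; last first.
      by move=> i _; exact: memvZ.
    rewrite -[X in X \in _]subr0 -[X in _ - X]e1.1 -sumrB memv_suml // => i _.
    by rewrite mxE -scalerBr memvZ.
  have cr : rsubmx c = 0.
    apply: zero; apply/eqP; rewrite -memv0 -SU memv_cap memv_suml /=; last first.
      by move=> i _; exact: memvZ.
    rewrite -[X in X \in _]subr0 -[X in _ - X]e1.2 -sumrB memv_suml // => i _.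
    by rewrite mxE -scalerBr subKr memvZ.
  by rewrite -[c]hsubmxK cl cr row_mx0.
- move=> i j; rewrite /m.
  by case: (fintype.split i) => i'; case: (fintype.split j) => j'; rewrite ?uu ?uw ?ww // bformC uw.
move=> g Hg gS.
pose A := \matrix_(i, j) coord (vbasis S) j (s i *m g).
have sg i : s i *m g = \sum_j A i j *: s j := gact_basis gS i.
have [_ gU gW _ _] := Hg.
(* [g] preserves [U] and [W], so uniqueness of the decomposition transfers its matrix on [S] to both
   components. *)
have uwg i : u i *m g = \sum_j A i j *: u j /\
    (s i - u i) *m g = \sum_j A i j *: (s j - u j).
  apply: (split_unique UIW).
  - by rewrite -gU memv_gact.
  - by apply: memv_suml => j _; exact: memvZ.
  - by rewrite -gW memv_gact.
  - by apply: memv_suml => j _; exact: memvZ.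
  rewrite -mulmxDl addrC subrK sg -big_split /=; apply: eq_bigr => j _.
  by rewrite -scalerDr addrC subrK.
exists (block_mx A 0 0 A); last by rewrite det_ublock -expr2 sqr_ge0.
move=> i; rewrite big_split_ord /=.
case: (split_ordP i) => k ->; rewrite ?ml ?mr.
  rewrite (uwg k).1 [X in _ = _ + X]big1 ?addr0.
    by apply: eq_bigr => j _; rewrite block_mxEul ml.
  by move=> j _; rewrite block_mxEur mxE scale0r.
rewrite (uwg k).2 [X in _ = X + _]big1 ?add0r.
  by apply: eq_bigr => j _; rewrite block_mxEdr mr.
by move=> j _; rewrite block_mxEdl mxE scale0r.
Qed.

End Stabilizers.

(** * Sufficient conditions for a class to occur in the stabilizer *)

Section Criteria.
Variables (R : realType) (n : nat).

Lemma stab_class_swap (B : {symmetric 'rV[R]_n}) U W c S b :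
  stab_class B W U c S b -> stab_class B U W c S b.
Proof. by case=> g [Hg gS cg]; exists g; split=> //; case: Hg. Qed.

Definition class_map (B : {symmetric 'rV[R]_n}) (c : 'M[R]_n -> bool * bool) :=
  [/\ forall g h, isometry_group B g -> isometry_group B h ->
        c (g *m h) = ((c g).1 (+) (c h).1, (c g).2 (+) (c h).2),
      forall v, 0 < B v v -> c (reflection B v) = (true, false) &
      forall v, B v v < 0 -> c (reflection B v) = (false, true)].

Lemma stab_classM (B : {symmetric 'rV[R]_n}) U W S c b b' :
  (U + W)%VS = fullv -> (U <= orthov B W)%VS -> class_map B c ->
  stab_class B U W c S b -> stab_class B U W c S b' ->
  stab_class B U W c S (b.1 (+) b'.1, b.2 (+) b'.2).
Proof.
move=> UWV UoW [cM _ _] [g [Hg gS <-]] [h [Hh hS <-]]; exists (g *m h); split.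
- exact: prodM.
- by rewrite gactM gS hS.
- by rewrite cM //; apply: (prod_iso UWV UoW).
Qed.

(** Vectors of [U] of both signs suffice: their reflections generate all four classes. *)
Lemma class_map_surj (B : {symmetric 'rV[R]_n}) U W c b :
  (U + W)%VS = fullv -> (U <= orthov B W)%VS -> class_map B c ->
  (0 < pos_dim B U)%N -> (0 < neg_dim B U)%N ->
  exists2 g, isometry_prod B U W g & c g = b.
Proof.
move=> UWV UoW [cM c_pos c_neg] p0 q0.
have [P [N [[PU NU dP dN] [[dimP dimN _ _] _]]]] := inertia B U.
have vP : 0 < B (vpick P) (vpick P).
  by rewrite dP ?memv_pick // vpick0 -dimv_eq0 dimP -lt0n.
have vN : B (vpick N) (vpick N) < 0.
  by rewrite dN ?memv_pick // vpick0 -dimv_eq0 dimN -lt0n.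
have vP0 : B (vpick P) (vpick P) != 0 by rewrite gt_eqF.
have HP : isometry_prod B U W (reflection B (vpick P)).
  by apply: (reflection_prod UoW vP0); left; rewrite (subvP PU) ?memv_pick.
have HN : isometry_prod B U W (reflection B (vpick N)).
  apply: (reflection_prod UoW); first by rewrite lt_eqF.
  by left; rewrite (subvP NU) ?memv_pick.
have [iP iN] := (prod_iso UWV UoW HP, prod_iso UWV UoW HN).
case: b => -[] [].
- exists (reflection B (vpick P) *m reflection B (vpick N)); first exact: prodM.
  by rewrite cM // c_pos // c_neg.
- by exists (reflection B (vpick P)); rewrite ?c_pos.
- by exists (reflection B (vpick N)); rewrite ?c_neg.
- exists 1%:M; first exact: prod1.
  by rewrite -(reflectionK vP0) cM // c_pos.
Qed.

Lemma stab_class_pos (B : {symmetric 'rV[R]_n}) U W S c :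
  (U + W)%VS = fullv -> (U <= orthov B W)%VS ->
  (U :&: orthov B U)%VS = 0%VS -> class_map B c ->
  (pos_dim B (sproj U W S) + \dim (Rad B (sproj U W S)) < pos_dim B U)%N ->
  stab_class B U W c S (true, false).
Proof.
move=> UWV UoW ndU [_ c_pos _] lt.
have [v [vU vX v0]] := exists_pos_orthov ndU (sproj_sub U W S) lt.
have vv : B v v != 0 by rewrite gt_eqF.
exists (reflection B v); split; last exact: c_pos.
  by apply: reflection_prod => //; left.
exact: (reflection_stab UWV UoW).
Qed.

Lemma stab_class_neg (B : {symmetric 'rV[R]_n}) U W S c :
  (U + W)%VS = fullv -> (U <= orthov B W)%VS ->
  (U :&: orthov B U)%VS = 0%VS -> class_map B c ->
  (neg_dim B (sproj U W S) + \dim (Rad B (sproj U W S)) < neg_dim B U)%N ->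
  stab_class B U W c S (false, true).
Proof.
move=> UWV UoW ndU [_ _ c_neg] lt.
have [||v [vU vX v0]] := @exists_pos_orthov _ _ (opsym B) U _ _ (sproj_sub U W S).
- by rewrite orthov_opsym.
- by rewrite !pos_dim_opsym Rad_opsym.
rewrite orthov_opsym in vX; rewrite opsymE oppr_gt0 in v0.
have vv : B v v != 0 by rewrite lt_eqF.
exists (reflection B v); split; last exact: c_neg.
  by apply: reflection_prod => //; left.
exact: (reflection_stab UWV UoW).
Qed.

Lemma stab_class_pair (B : {symmetric 'rV[R]_n}) U W S c x y :
  (U + W)%VS = fullv -> (U <= orthov B W)%VS -> (S <= orthov B S)%VS ->
  class_map B c ->
  x \in U \/ x \in W -> y \in U \/ y \in W ->
  B x y = 0 -> B y y = - B x x -> B x x != 0 -> x + y \in S ->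
  stab_class B U W c S (true, true).
Proof.
move=> UWV UoW SS [cM c_pos c_neg] xUW yUW xy yx x0 xyS.
have y0 : B y y != 0 by rewrite yx oppr_eq0.
exists (reflection B x *m reflection B y); split.
- by apply: prodM => //; apply: reflection_prod.
- exact: reflection_pair_stab.
- rewrite cM; do ?exact: reflection_iso.
  move: x0; rewrite neq_lt => /orP[x0|x0].
    by rewrite c_neg // c_pos // yx oppr_gt0.
  by rewrite c_pos // c_neg // yx oppr_lt0.
Qed.

(** A nonzero vector of [S :&: U] or [S :&: W] is split by [isotropic_split] inside that summand; if
    both intersections vanish, [pair_in_sproj] gives a pair across the two summands. *)
Lemma stab_class_both (B : {symmetric 'rV[R]_n}) U W S c :
  (U + W)%VS = fullv -> (U <= orthov B W)%VS -> (S <= orthov B S)%VS ->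
  (U :&: orthov B U)%VS = 0%VS -> (W :&: orthov B W)%VS = 0%VS ->
  class_map B c ->
  (0 < \dim (S :&: U) + \dim (S :&: W) + pos_dim B (sproj U W S) +
       neg_dim B (sproj U W S))%N ->
  stab_class B U W c S (true, true).
Proof.
move=> UWV UoW SS ndU ndW cc pos.
have hyp X : (X :&: orthov B X)%VS = 0%VS -> X = U \/ X = W ->
    (0 < \dim (S :&: X))%N -> stab_class B U W c S (true, true).
  move=> ndX XUW SX; have SX0 : (S :&: X)%VS != 0%VS by rewrite -dimv_eq0 -lt0n.
  have := memv_pick (S :&: X)%VS; have := SX0; rewrite -vpick0.
  move: (vpick _) => x x0; rewrite memv_cap => /andP[xS xX].
  have xx : B x x = 0 by exact: (orthov_eq0 (subvP SS _ xS) xS).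
  have [u [w [[uX wX] uw ww u0 uwx]]] := isotropic_split ndX xX x0 xx.
  apply: (stab_class_pair UWV UoW SS cc (x := u) (y := w)) => //.
  - by case: XUW => <-; [left|right].
  - by case: XUW => <-; [left|right].
  - by rewrite uwx.
have [U0|U0] := posnP (\dim (S :&: U)); last by apply: (hyp U) => //; left.
have [W0|W0] := posnP (\dim (S :&: W)); last by apply: (hyp W) => //; right.
have [|u [w [[uU wW] uw ww u0 uwS]]] := @pair_in_sproj _ _ B U W S UoW SS.
  by move: pos; rewrite U0 W0; lia.
apply: (stab_class_pair UWV UoW SS cc (x := u) (y := w)) => //; first by left.
by right.
Qed.

End Criteria.

(** * Counting the orbits case by case *)

Unset Implicit Arguments.

Theorem theorem5p10 (R : realType) (p q p1 q1 : nat)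
    (hp1 : (0 < p1)%N) (hq1 : (0 < q1)%N) (hp : (0 < p)%N) (hq : (0 < q)%N)
    (hpp1 : (p1 < p)%N) (hqq1 : (q1 < q)%N)
    (B : {symmetric 'rV[R]_(p + q)}) (U W : {vspace 'rV[R]_(p + q)})
    (hB : nondegenerate B) (hV : has_signature B fullv p q)
    (hUW : (U + W)%VS = fullv) (hUIW : (U :&: W)%VS = 0%VS)
    (hperp : (U <= orthov B W)%VS)
    (hU : has_signature B U p1 q1) (hW : has_signature B W (p - p1) (q - q1))
    (r : nat) (hr : (r <= minn p q)%N)
    (rU rW a bU bW : nat) (O : set {vspace 'rV[R]_(p + q)})
    (hO : exists2 S, Gr B r S & O = orbit_of (isometry_prod B U W) S)
    (hinv : forall S, O S -> invariants B U W S = (rU, rW, a, bU, bW)) :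
  let H0 := isometry_prod B U W `&` identity_component B in
  [/\ case1 p q p1 q1 rU rW a bU bW -> orbits_in H0 O #= `I_4,
      case2 p q p1 q1 rU rW a bU bW -> orbits_in H0 O #= `I_2
    & ~~ case1 p q p1 q1 rU rW a bU bW -> ~~ case2 p q p1 q1 rU rW a bU bW ->
      orbits_in H0 O #= `I_1].
Proof.
move=> H0.
have [S0 [dimS SS] OE] := hO.
have O_S : O S0.
  by rewrite OE; exists 1%:M; rewrite ?gact1 //; exact: prod1.
case: (hinv S0 O_S) => rUE rWE aE bUE bWE.
case: hV => _ ppos pneg; case: hU => ndU Upos Uneg; case: hW => ndW Wpos Wneg.
have hWU : (W + U)%VS = fullv by rewrite addvC.
have hWIU : (W :&: U)%VS = 0%VS by rewrite capvC.
have hperp' : (W <= orthov B U)%VS by rewrite orthov_sym.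
(* The subtraction that defines [a] is not truncated, since [S0 :&: U] lies in the radical. *)
have RadU : \dim (Rad B (sproj U W S0)) = (rU + a)%N.
  by have := dimvS (cap_sub_Rad_sproj hperp SS); lia.
have [_ [_ [_ [_ inU]]]] := inertia B (sproj U W S0).
have [_ [_ [_ [_ inW]]]] := inertia B (sproj W U S0).
have bW' : pos_dim B (sproj W U S0) = bW by rewrite -neg_dim_sproj.
have bU' : neg_dim B (sproj W U S0) = bU by rewrite neg_dim_sproj.
have dimSU := dim_sproj S0 hUW hUIW.
have dimSW := dim_sproj S0 hWU hWIU.
(* Both projections have their dimension tied to that of [S0] and have exchanged signatures, so [a]
   is the same on either side. *)
have RadW : \dim (Rad B (sproj W U S0)) = (rW + a)%N by lia.
have dimSE : \dim S0 = (rU + rW + a + bU + bW)%N by lia.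
have boundU := pos_dim_rad_le ndU (sproj_sub U W S0).
have boundW := pos_dim_rad_le ndW (sproj_sub W U S0).
have boundU' : (bW + (rU + a) <= q1)%N.
  have ndU' : (U :&: orthov (opsym B) U)%VS = 0%VS by rewrite orthov_opsym.
  have := pos_dim_rad_le ndU' (sproj_sub U W S0).
  by rewrite !pos_dim_opsym Rad_opsym RadU bWE Uneg.
have boundW' : (bU + (rW + a) <= q - q1)%N.
  have ndW' : (W :&: orthov (opsym B) W)%VS = 0%VS by rewrite orthov_opsym.
  have := pos_dim_rad_le ndW' (sproj_sub W U S0).
  by rewrite !pos_dim_opsym Rad_opsym RadW bU' Wneg.
rewrite RadU bUE Upos in boundU; rewrite RadW bW' Wpos in boundW.
have [c [cM c0 [c_pos c_neg] ciso1 ciso2]] := component_class hB ppos pneg hp hq.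
have cc : class_map B c by split.
pose T := stab_class B U W c S0.
have T00 : T (false, false).
  exists 1%:M; split; [exact: prod1 | exact: gact1 |].
  have /c0[] // : identity_component B 1%:M.
  by apply: connected_component_refl; exact: iso1.
have TM b b' : T b -> T b' -> T (b.1 (+) b'.1, b.2 (+) b'.2).
  exact: stab_classM.
have A_U : (rU + a + bU < p1)%N -> T (true, false).
  by move=> lt; apply: stab_class_pos => //; rewrite RadU bUE Upos; lia.
have A_W : (rW + a + bW < p - p1)%N -> T (true, false).
  move=> lt; apply: stab_class_swap; apply: stab_class_pos => //.
  by rewrite RadW bW' Wpos; lia.
have C_U : (rU + a + bW < q1)%N -> T (false, true).
  by move=> lt; apply: stab_class_neg => //; rewrite RadU bWE Uneg; lia.
have C_W : (rW + a + bU < q - q1)%N -> T (false, true).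
  move=> lt; apply: stab_class_swap; apply: stab_class_neg => //.
  by rewrite RadW bU' Wneg; lia.
have D : (0 < rU + rW + bU + bW)%N -> T (true, true).
  by move=> pos; apply: stab_class_both => //; rewrite rUE rWE bUE bWE; lia.
have stab_iso t : isometry_prod B U W t -> isometry_group B t.
  exact: prod_iso.
(* The family may be indexed by any [k] equal to [p], so that bases indexed by a dimension fit. *)
have ciso1' k g (m : 'I_k -> 'rV[R]_(p + q)) (A : 'M[R]_k) : k = p ->
    isometry_group B g -> isotropic_free B m ->
    (forall i, m i *m g = \sum_j A i j *: m j) -> (c g).1 = (\det A < 0).
  by move=> ek; subst k; exact: ciso1.
have ciso2' k g (m : 'I_k -> 'rV[R]_(p + q)) (A : 'M[R]_k) : k = q ->
    isometry_group B g -> isotropic_free B m ->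
    (forall i, m i *m g = \sum_j A i j *: m j) -> (c g).2 = (\det A < 0).
  by move=> ek; subst k; exact: ciso2.
(* Here [S0] has dimension [a], so the doubled family has [2 * a] members and its nonnegative
   determinant fixes the matching sign. *)
have double : (rU, rW, bU, bW) = (0, 0, 0, 0)%N -> forall b, T b ->
    (p = (2 * a)%N -> b.1 = false) /\ (q = (2 * a)%N -> b.2 = false).
  case=> rU0 rW0 bU0 bW0 _ [t [Ht tS <-]].
  have SU0 : (S0 :&: U)%VS = 0%VS by apply/eqP; rewrite -dimv_eq0 rUE rU0.
  have SW0 : (S0 :&: W)%VS = 0%VS by apply/eqP; rewrite -dimv_eq0 rWE rW0.
  have PP : (sproj U W S0 <= orthov B (sproj U W S0))%VS.
    have RX : (Rad B (sproj U W S0) <= sproj U W S0)%VS by exact: capvSl.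
    have /eqP PR : Rad B (sproj U W S0) == sproj U W S0.
      by rewrite eqEdim RX; lia.
    by apply/orthovP => x y; rewrite -{1}PR memv_cap => /andP[_]; exact: orthov_eq0.
  have [m [m_iso mA]] := isotropic_double hUW hUIW hperp SS SU0 SW0 PP.
  have [A mg dA] := mA t Ht tS.
  split=> e.
    rewrite (ciso1' _ t m A _ (stab_iso _ Ht) m_iso mg); last by lia.
    by rewrite ltNge dA.
  rewrite (ciso2' _ t m A _ (stab_iso _ Ht) m_iso mg); last by lia.
  by rewrite ltNge dA.
(* [L] has dimension [p = q], so the same determinant computes both signs. *)
have single : p = q -> p = (\dim S0 + a)%N -> forall b, T b -> b.1 = b.2.
  move=> pq pE _ [t [Ht tS <-]].
  pose L := (S0 + Rad B (sproj U W S0))%VS.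
  have dimL : \dim L = p.
    by have := dim_add_Rad hperp SS; rewrite -/L; lia.
  have L_iso := isotropic_basis (add_Rad_isotropic hUW hperp SS).
  have tL : gact t L = L.
    by rewrite gact_add tS (gact_Rad (stab_iso _ Ht) (gact_sproj Ht tS)).
  rewrite (ciso1' _ t _ _ dimL (stab_iso _ Ht) L_iso (gact_basis tL)).
  by rewrite (ciso2' _ t _ _ _ (stab_iso _ Ht) L_iso (gact_basis tL)) // dimL.
have card m l := @orbits_in_card _ _ B U W hUW hperp c cM c0 S0 m l.
have csurj b : exists2 g, isometry_prod B U W g & c g = b.
  by apply: class_map_surj; rewrite ?Upos ?Uneg.
rewrite OE /H0; split.
- case/and5P=> /eqP pE /eqP qE /eqP p1E /eqP q1E /eqP D0.
  (* [T] is trivial, so the label is injective: the two bits read in binary. *)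
  apply: (card 4%N (fun b => b.1 + 2 * b.2)%N csurj) => [b b'|[[] []] //|].
    split=> [|/double-/(_ D0)[/(_ pE) + /(_ qE)]].
      by case: b b' => [[] []] [[] []].
    by case: b b' => [[] []] [[] []].
  move=> [|[|[|[|]]]] // _.
  + by exists (false, false).
  + by exists (true, false).
  + by exists (false, true).
  + by exists (true, true).
(* It suffices to find a nonconstant boolean label whose level sets are the cosets of [T]. *)
- move=> h2; suff [l [lb lT]] : exists l : bool * bool -> bool,
      (exists2 b, l b & exists b', ~~ l b') /\
      forall b b', l b = l b' <-> T (b.1 (+) b'.1, b.2 (+) b'.2).
    apply: (card 2%N l csurj) => [b b'||].
    + split=> [e|/lT -> //]; apply/lT; move: e.
      by case: (l b); case: (l b').
    + by move=> b; case: (l b).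
    + case: lb => b lb [b' lb'] [|[|]] // _; first by exists b'; rewrite (negPf lb').
      by exists b; rewrite lb.
  case/or3P: h2.
  + case/and5P=> /eqP qE /eqP q1E /eqP D0 ap1 /andP[ap2 lt].
    (* As [2 * a < p], one of [U] and [W] leaves room for a positive vector. *)
    have T10 : T (true, false).
      have [lt1|ge1] := ltnP (rU + a + bU) p1; first exact: A_U.
      by apply: A_W; case: D0; lia.
    exists snd; split; first by exists (true, true) => //; exists (false, false).
    move=> b b'; split=> [|/double-/(_ D0)[_ /(_ qE)]].
      by case: b b' => [[] []] [[] []].
    by case: b b' => [[] []] [[] []].
  + case/and5P=> /eqP pE /eqP p1E /eqP D0 ap1 /andP[ap2 lt].
    have T01 : T (false, true).
      have [lt1|ge1] := ltnP (rU + a + bW) q1; first exact: C_U.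
      by apply: C_W; case: D0; lia.
    exists fst; split; first by exists (true, true) => //; exists (false, false).
    move=> b b'; split=> [|/double-/(_ D0)[/(_ pE)]].
      by case: b b' => [[] []] [[] []].
    by case: b b' => [[] []] [[] []].
  + case/and5P=> /eqP pq /eqP e1 /eqP e2 /eqP e3 /andP[/eqP e4 pos].
    have T11 : T (true, true) by apply: D; lia.
    (* [T] is the diagonal, so the parity of the bits separates its cosets. *)
    exists (fun b => b.1 (+) b.2); split.
      by exists (true, false) => //; exists (false, false).
    move=> b b'; split=> [|/single].
      by case: b b' => [[] []] [[] []].
    have pE : p = (\dim S0 + a)%N by lia.
    move=> /(_ pq pE).
    by case: b b' => [[] []] [[] []].
- move=> n1 n2.
  suff allT b : T b.
    apply: (card 1%N (fun=> 0%N) csurj) => [b b'|//|[|]// _].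
      by split=> // _; exact: allT.
    by exists (false, false).
  (* Any two of the three nontrivial classes generate the group. *)
  suff : (T (true, false) /\ T (false, true)) \/
         (T (true, false) /\ T (true, true)) \/ (T (false, true) /\ T (true, true)).
    case: b => [[] []] // [|[|]] [t1 t2] //; by have := TM _ _ t1 t2.
  have fA : T (true, false) \/ (p1 = rU + a + bU /\ p - p1 = rW + a + bW)%N.
    have [lt1|ge1] := ltnP (rU + a + bU) p1; first by left; exact: A_U.
    have [lt2|ge2] := ltnP (rW + a + bW) (p - p1); first by left; exact: A_W.
    by right; lia.
  have fC : T (false, true) \/ (q1 = rU + a + bW /\ q - q1 = rW + a + bU)%N.
    have [lt1|ge1] := ltnP (rU + a + bW) q1; first by left; exact: C_U.
    have [lt2|ge2] := ltnP (rW + a + bU) (q - q1); first by left; exact: C_W.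
    by right; lia.
  have fD : T (true, true) \/ (rU = 0 /\ rW = 0 /\ bU = 0 /\ bW = 0)%N.
    have [z|pos] := posnP (rU + rW + bU + bW); last by left; exact: D.
    by right; lia.
  case: fA fC => [tA|[eA eA']] [tC|[eC eC']]; first by left.
  + case: fD => [tD|[e1 [e2 [e3 e4]]]]; first by right; left.
    (* Now [q1 = a] and [q = 2 * a]; case 1 being excluded, [p] exceeds [2 * a] and this is case
       2a. *)
    case/negP: n2; apply/or3P; apply: Or31; rewrite /case2a e1 e2 e3 e4 eqxx.
    move: n1; rewrite /case1 e1 e2 e3 e4 eqxx; clear -boundU boundW eC eC' e1 e2 e3 e4 hqq1 hpp1.
    by lia.
  + case: fD => [tD|[e1 [e2 [e3 e4]]]]; first by right; right.
    case/negP: n2; apply/or3P; apply: Or32; rewrite /case2b e1 e2 e3 e4 eqxx.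
    move: n1; rewrite /case1 e1 e2 e3 e4 eqxx; clear -boundU' boundW' eA eA' e1 e2 e3 e4 hqq1 hpp1.
    by lia.
  (* No room is left for either sign, which forces [p = q]: case 1 if the four invariants vanish,
     case 2c otherwise. *)
  + have [z|pos] := posnP (rU + rW + bU + bW).
      have [e1 [e2 [e3 e4]]] : (rU = 0 /\ rW = 0 /\ bU = 0 /\ bW = 0)%N by lia.
      case/negP: n1; rewrite /case1 e1 e2 e3 e4 eqxx.
      by clear -eA eA' eC eC' e1 e2 e3 e4 hqq1 hpp1; lia.
    case/negP: n2; apply/or3P; apply: Or33; rewrite /case2c.
    by clear -eA eA' eC eC' pos hqq1 hpp1; lia.
Qed.
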